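(* There is a polynomial-time algorithm that, given an implicational base $(U,\Sigma)$ of a convex geometry $(U,\mathcal{F})$ such that, for every essential set $C$ of $(U,\mathcal{F})$, the quasi-closed hypergraph $\mathcal{Q}(C)$ has pairwise disjoint edges, outputs an optimum implicational base of $(U,\mathcal{F})$ (i.e., an equivalent implicational base of minimum total size). In other words, such implicational bases can be optimized in polynomial time.
   Context: All sets are finite. A closure system is a pair $(U,\mathcal{F})$ with $\mathcal{F}\subseteq 2^U$, $U\in\mathcal{F}$, closed under intersection; its closure operator is $\phi(A)=\bigcap\{C\in\mathcal{F}: A\subseteq C\}$. $(U,\mathcal{F})$ is a convex geometry if $\emptyset\in\mathcal{F}$ and for every closed $C\subsetneq U$ there is $x\notin C$ with $C\cup\{x\}$ closed. A set $Q\subseteq U$ is quasi-closed if $Q$ is not closed and for every $A\subseteq Q$, $\phi(A)\subsetneq\phi(Q)$ implies $\phi(A)\subseteq Q$. A closed set $C$ is essential if $C=\phi(Q)$ for some quasi-closed $Q$; the quasi-closed sets of $C$ are the quasi-closed $Q$ with $\phi(Q)=C$. The quasi-closed hypergraph $\mathcal{Q}(C)$ has vertex set $C$ and edges $C\setminus Q$ for $Q$ ranging over the inclusion-wise maximal quasi-closed sets of $C$. An implication over $U$ is $A\to B$ with $A,B\subseteq U$; a set $X$ satisfies it if $A\subseteq X$ implies $B\subseteq X$. $(U,\Sigma)$ is an implicational base of $(U,\mathcal{F})$ if $\mathcal{F}$ is exactly the family of subsets of $U$ satisfying all implications in $\Sigma$. The total size of $\Sigma$ is $\sum_{A\to B\in\Sigma}(|A|+|B|)$;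 an implicational base of $(U,\mathcal{F})$ is optimum if it has minimum total size among all implicational bases of $(U,\mathcal{F})$. Polynomial time is measured in $|U|$ and the total size of the input $\Sigma$. *)

(* Defs.v *)
From mathcomp Require Import all_boot.

Set Implicit Arguments.
Unset Strict Implicit.
Unset Printing Implicit Defensive.

(* Model of computation: the WHILE language of N. D. Jones (Computability and
   Complexity from a Programming Perspective) over binary trees with a single
   atom. Trees are not compared by a primitive operation; a test only
   distinguishes [leaf] from [node _ _]. *)

Inductive tree := leaf | node of tree & tree.

Fixpoint tree_size (d : tree) : nat :=
  if d is node l r then (tree_size l + tree_size r).+1 else 1.

Definition left_tree (d : tree) := if d is node l _ then l else leaf.
Definition right_tree (d : tree) := if d is node _ r then r else leaf.
Definition is_node (d : tree) := if d is node _ _ then true else false.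

Inductive expr :=
  | EVar of nat
  | ELeaf
  | ENode of expr & expr
  | ELeft of expr
  | ERight of expr.

Inductive cmd :=
  | CSkip
  | CAssign of nat & expr
  | CSeq of cmd & cmd
  | CIf of expr & cmd & cmd
  | CWhile of expr & cmd.

Definition store := nat -> tree.

Definition store_set (s : store) (x : nat) (d : tree) : store :=
  fun y => if y == x then d else s y.

Fixpoint eval (s : store) (e : expr) : tree :=
  match e with
  | EVar x => s x
  | ELeaf => leaf
  | ENode e1 e2 => node (eval s e1) (eval s e2)
  | ELeft e1 => left_tree (eval s e1)
  | ERight e1 => right_tree (eval s e1)
  end.

(* Every subexpression is charged the full size of its value, so that neither
   copying nor sharing is free. Hence the size of the store grows by at most
   the time spent, and running times agree with those of Turing machines up to
   a polynomial. *)
Fixpoint eval_time (s : store) (e : expr) : nat :=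
  tree_size (eval s e) +
  match e with
  | EVar _ | ELeaf => 0
  | ENode e1 e2 => eval_time s e1 + eval_time s e2
  | ELeft e1 | ERight e1 => eval_time s e1
  end.

(* [exec c s t s']: run from the store [s], the command [c] halts in time [t]
   with the store [s']. *)
Inductive exec : cmd -> store -> nat -> store -> Prop :=
  | exec_skip s : exec CSkip s 1 s
  | exec_assign s x e :
      exec (CAssign x e) s (eval_time s e).+1 (store_set s x (eval s e))
  | exec_seq c1 c2 s1 s2 s3 t1 t2 :
      exec c1 s1 t1 s2 -> exec c2 s2 t2 s3 ->
      exec (CSeq c1 c2) s1 (t1 + t2).+1 s3
  | exec_if e c1 c2 s s' t :
      exec (if is_node (eval s e) then c1 else c2) s t s' ->
      exec (CIf e c1 c2) s (eval_time s e + t).+1 s'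
  | exec_while_done e c s :
      ~~ is_node (eval s e) -> exec (CWhile e c) s (eval_time s e).+1 s
  | exec_while_step e c s1 s2 s3 t1 t2 :
      is_node (eval s1 e) -> exec c s1 t1 s2 -> exec (CWhile e c) s2 t2 s3 ->
      exec (CWhile e c) s1 (eval_time s1 e + t1 + t2).+1 s3.

Lemma exec_det c s t1 s1 t2 s2 :
  exec c s t1 s1 -> exec c s t2 s2 -> t1 = t2 /\ s1 = s2.
Proof.
move=> H; elim: H t2 s2 => {c s t1 s1}.
- by move=> s t2 s2 H; inversion H.
- by move=> s x e t2 s2 H; inversion H.
- move=> c1 c2 s1 s2 s3 t1 t2 _ IH1 _ IH2 t s H.
  inversion H as [| |? ? ? ? ? ? ? E1 E2| | |]; subst.
  by case: (IH1 _ _ E1) => ? ?; subst; case: (IH2 _ _ E2) => -> ->.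
- move=> e c1 c2 s s' t _ IH t2 s2 H.
  inversion H as [| | |? ? ? ? ? ? E| |]; subst.
  by case: (IH _ _ E) => -> ->.
- move=> e c s n t2 s2 H.
  inversion H as [| | | | |? ? ? ? ? ? ? b]; subst => //.
  by rewrite b in n.
- move=> e c s1 s2 s3 t1 t2 b _ IH1 _ IH2 t s H.
  inversion H as [| | | |? ? ? n|? ? ? ? ? ? ? _ E1 E2]; subst.
    by rewrite b in n.
  by case: (IH1 _ _ E1) => ? ?; subst; case: (IH2 _ _ E2) => -> ->.
Qed.

(* A program reads its input from variable 0 and leaves its output there. *)
Definition init_store (d : tree) : store := store_set (fun=> leaf) 0 d.
Definition output (s : store) : tree := s 0.

Notation implication U := ({set U} * {set U})%type.

Section ClosureSystems.
Variable U : finType.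
Implicit Types (F : {set {set U}}) (A C Q X : {set U}).

Definition closure_system F : Prop :=
  setT \in F /\ {in F &, forall C D, C :&: D \in F}.

Definition closure_op F A : {set U} := \bigcap_(C in F | A \subset C) C.

Definition convex_geometry F : Prop :=
  [/\ closure_system F, set0 \in F &
      forall C, C \in F -> C \proper setT ->
        exists2 x, x \notin C & x |: C \in F].

Definition quasi_closed F Q : bool :=
  (Q \notin F) &&
  [forall A : {set U}, (A \subset Q) ==>
     (closure_op F A \proper closure_op F Q) ==> (closure_op F A \subset Q)].

Definition quasi_closed_of F C Q : bool :=
  quasi_closed F Q && (closure_op F Q == C).

Definition essential F C : bool :=
  (C \in F) && [exists Q : {set U}, quasi_closed_of F C Q].

Record hypergraph := Hypergraph {
  vertices : {set U};
  edges : {set {set U}}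
}.

Definition quasi_closed_hypergraph F C : hypergraph :=
  Hypergraph C [set C :\: Q | Q : {set U} & maxset (quasi_closed_of F C) Q].

Implicit Types (Sigma : {set implication U}).

Definition satisfies X (i : implication U) : bool :=
  (i.1 \subset X) ==> (i.2 \subset X).

Definition implicational_base F Sigma : Prop :=
  F = [set X : {set U} | [forall i in Sigma, satisfies X i]].

Definition total_size Sigma : nat := \sum_(i in Sigma) (#|i.1| + #|i.2|).

Definition optimum_base F Sigma : Prop :=
  implicational_base F Sigma /\
  forall Sigma', implicational_base F Sigma' ->
    total_size Sigma <= total_size Sigma'.

End ClosureSystems.

(* A vertex is encoded by its rank in the enumeration of [U], written in
   unary; a set is encoded by the list of its elements in any order, and an
   implicational base by the list of its implications in any order, always
   without repetition. *)
Section Encoding.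
Variable U : finType.
Implicit Types (l : seq (seq U * seq U)).

Definition tree_of_list (s : seq tree) : tree := foldr node leaf s.

Definition tree_of_nat (n : nat) : tree := tree_of_list (nseq n leaf).

Definition code_vertices (s : seq U) : tree :=
  tree_of_list [seq tree_of_nat (enum_rank x) | x <- s].

Definition code_implications l : tree :=
  tree_of_list [seq node (code_vertices i.1) (code_vertices i.2) | i <- l].

Definition code_input l : tree :=
  node (code_vertices (enum U)) (code_implications l).

Definition listed_implications l : seq (implication U) :=
  [seq ([set x in i.1], [set x in i.2]) | i <- l].

Definition lists l (Sigma : {set implication U}) : bool :=
  [&& all (fun i => uniq i.1 && uniq i.2) l,
      uniq (listed_implications l) &
      [set i in listed_implications l] == Sigma].

End Encoding.

(* Main.v *)
(* In a convex geometry every essential closed set C has a least generating set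
   ex(C), which is the premise of some implication of every base closing to C
   at the least possible cost. The conclusions of the implications whose premise
   generates C must meet every edge of the quasi-closed hypergraph Q(C), and
   conversely an implication ex(C) -> B for every essential C, with B a
   transversal of Q(C), yields a base. So the optimum is the sum over C of
   |ex(C)| and the transversal number of Q(C). When the edges of Q(C) are
   disjoint, any inclusion-minimal transversal is minimum, and the following
   greedy algorithm is optimal: shrink the premises while they keep their
   closure, replace the conclusions by the closures of the premises, then drop
   elements of conclusions one at a time as long as forward chaining recovers
   them. An implication followed by another one with the same closure loses its
   whole conclusion in the process.
   The algorithm is a composition of folds over lists whose accumulator grows
   by a polynomially bounded amount at each step, and such functions are
   computed by WHILE programs in polynomial time. *)
Require Import Defs.
From mathcomp Require Import all_boot.
From mathcomp Require Import zify.

Set Implicit Arguments.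
Unset Strict Implicit.
Unset Printing Implicit Defensive.

(** * Polynomial time for WHILE programs *)

(** The instances reuse [tree_of_nat] and [tree_of_list], so that lists of ranks are encoded exactly
    as the input format prescribes, and a number has the same code as a list of units. *)
Class encodable (A : Type) := encode : A -> tree.

#[global] Instance encodable_unit : encodable unit := fun=> leaf.
#[global] Instance encodable_bool : encodable bool :=
  fun b => if b then node leaf leaf else leaf.
#[global] Instance encodable_nat : encodable nat := tree_of_nat.
#[global] Instance encodable_prod A B (eA : encodable A) (eB : encodable B) :
  encodable (A * B) := fun p => node (encode p.1) (encode p.2).
#[global] Instance encodable_seq A (eA : encodable A) : encodable (seq A) :=
  fun s => tree_of_list (map encode s).

Definition code_size A {eA : encodable A} (a : A) := tree_size (encode a).

Lemma tree_size_gt0 d : 0 < tree_size d. Proof. by case: d. Qed.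

Lemma code_size_gt0 A {eA : encodable A} (a : A) : 0 < code_size a.
Proof. exact: tree_size_gt0. Qed.

Lemma code_size_pair A B {eA : encodable A} {eB : encodable B} (a : A) (b : B) :
  code_size (a, b) = (code_size a + code_size b).+1.
Proof. by []. Qed.

Lemma code_size_cons A {eA : encodable A} (a : A) (s : seq A) :
  code_size (a :: s) = (code_size a + code_size s).+1.
Proof. by []. Qed.

Lemma size_code_size A {eA : encodable A} (s : seq A) : size s < code_size s.
Proof.
by elim: s => [|x s IH] //=; rewrite code_size_cons; have := code_size_gt0 x; lia.
Qed.

(** * Polynomially bounded functions of the code size *)

Section PolyBounded.
Context {A : Type} {eA : encodable A}.
Implicit Types f g : A -> nat.

(** A single power stands for an arbitrary polynomial: the base is at least 2, so constants, sums
    and products are absorbed by a larger exponent. *)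
Definition poly_bounded f :=
  exists k, forall a, f a <= (code_size a + 2) ^ k.

Lemma poly_bounded_le f g :
  (forall a, f a <= g a) -> poly_bounded g -> poly_bounded f.
Proof. by move=> fg [k gk]; exists k => a; apply: leq_trans (gk a). Qed.

Lemma poly_bounded_const n : poly_bounded (fun=> n).
Proof.
exists n => a; apply: leq_trans (ltnW (ltn_expl n (ltnSn 1))) _.
by case: n => // n; rewrite leq_exp2r // leq_addl.
Qed.

Lemma poly_bounded_size : poly_bounded (@code_size A eA).
Proof. by exists 1 => a; rewrite expn1 leq_addr. Qed.

Lemma poly_bounded_mul f g :
  poly_bounded f -> poly_bounded g -> poly_bounded (fun a => f a * g a).
Proof. by case=> k fk [l gl]; exists (k + l) => a; rewrite expnD leq_mul. Qed.

Lemma poly_bounded_add f g :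
  poly_bounded f -> poly_bounded g -> poly_bounded (fun a => f a + g a).
Proof.
case=> k fk [l gl]; exists (k + l).+1 => a.
have n0 j : 0 < (code_size a + 2) ^ j by rewrite expn_gt0 addn_gt0 orbT.
apply: leq_trans (leq_add (fk a) (gl a)) _.
by rewrite expnS expnD; have := n0 k; have := n0 l; nia.
Qed.

Lemma poly_bounded_exp f k : poly_bounded f -> poly_bounded (fun a => f a ^ k).
Proof.
move=> fP; elim: k => [|k IH]; first exact: poly_bounded_const.
by apply: poly_bounded_le (poly_bounded_mul fP IH) => a; rewrite expnS.
Qed.
End PolyBounded.

Lemma poly_bounded_comp A B {eA : encodable A} {eB : encodable B}
    (f : A -> B) (g : B -> nat) :
  poly_bounded (fun a => code_size (f a)) -> poly_bounded g ->
  poly_bounded (fun a => g (f a)).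
Proof.
move=> fP [k gk]; apply: poly_bounded_le (fun a => gk (f a)) _.
by apply/poly_bounded_exp/poly_bounded_add => //; apply: poly_bounded_const.
Qed.

(** * Program logic with time budgets *)

Section Runs.
Implicit Types (c : cmd) (s : store) (Q : store -> Prop).

Definition runs c s b Q := exists t s', [/\ exec c s t s', t <= b & Q s'].

Lemma runs_weaken c s b b' Q Q' :
  runs c s b Q -> b <= b' -> (forall s', Q s' -> Q' s') -> runs c s b' Q'.
Proof.
by case=> t [s' [e tb q]] bb' qq'; exists t, s'; split; [|lia|apply: qq'].
Qed.

Lemma runs_assign x e s Q :
  Q (store_set s x (eval s e)) -> runs (CAssign x e) s (eval_time s e).+1 Q.
Proof.
move=> q; exists (eval_time s e).+1, (store_set s x (eval s e)).
by split=> //; constructor.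
Qed.

Lemma runs_seq c1 c2 s b1 b2 Q :
  runs c1 s b1 (fun s' => runs c2 s' b2 Q) -> runs (CSeq c1 c2) s (b1 + b2).+1 Q.
Proof.
case=> t1 [s1 [e1 tb1 [t2 [s2 [e2 tb2 q]]]]].
by exists (t1 + t2).+1, s2; split; [apply: exec_seq e1 e2|lia|].
Qed.

Lemma runs_if e c1 c2 s b Q :
  runs (if is_node (eval s e) then c1 else c2) s b Q ->
  runs (CIf e c1 c2) s (eval_time s e + b).+1 Q.
Proof.
by case=> t [s' [ex tb q]]; exists (eval_time s e + t).+1, s'; split; [constructor|lia|].
Qed.

Lemma runs_while_done e c s Q :
  ~~ is_node (eval s e) -> Q s -> runs (CWhile e c) s (eval_time s e).+1 Q.
Proof. by move=> n q; exists (eval_time s e).+1, s; split=> //; constructor. Qed.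

Lemma runs_while_step e c s b1 b2 Q :
  is_node (eval s e) -> runs c s b1 (fun s' => runs (CWhile e c) s' b2 Q) ->
  runs (CWhile e c) s (eval_time s e + b1 + b2).+1 Q.
Proof.
move=> n [t1 [s1 [e1 tb1 [t2 [s2 [e2 tb2 q]]]]]].
by exists (eval_time s e + t1 + t2).+1, s2; split; [apply: exec_while_step n e1 e2|lia|].
Qed.
End Runs.

Ltac simpl_store := rewrite /store_set /=; repeat
  match goal with |- context [@eq_op ?T ?a ?b] =>
    first [have -> : (@eq_op T a b) = true by lia
          |have -> : (@eq_op T a b) = false by lia] end; rewrite /=.

(* The result is uniform in the store: [c] may use any variable below [m] as
   scratch space and leaves the others alone, which lets a caller keep its own
   data above [m]. *)
Definition computes A B {eA : encodable A} {eB : encodable B} (f : A -> B)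
    (c : cmd) (m : nat) (T : A -> nat) :=
  forall a s, s 0 = encode a ->
  runs c s (T a) (fun s' => s' 0 = encode (f a) /\ forall x, m <= x -> s' x = s x).

(** The output size is bounded too, because in a composition the time bound of the second program is
    evaluated at the output of the first. *)
Definition poly_time A B {eA : encodable A} {eB : encodable B} (f : A -> B) :=
  poly_bounded (fun a => code_size (f a)) /\
  exists c m (T : A -> nat), [/\ poly_bounded T, 0 < m & computes f c m T].

(** * Composition, pairing and branching in polynomial time *)

Section Combinators.
Context {A B C : Type} {eA : encodable A} {eB : encodable B} {eC : encodable C}.

(** Programs only see codes, so a function may be traded for one into another type with the same
    trees: a cons for a pair, a list of units for a number. *)
Lemma poly_time_code (f : A -> B) (g : A -> C) :
  (forall a, encode (f a) = encode (g a)) -> poly_time g -> poly_time f.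
Proof.
move=> fg [gs [c [m [T [TP m0 cg]]]]]; split.
  by apply: poly_bounded_le gs => a; rewrite /code_size fg.
by exists c, m, T; split=> // a s sa; rewrite fg; apply: cg.
Qed.

Lemma poly_time_expr (f : A -> B) (e : expr) (K : nat) :
  (forall s a, s 0 = encode a ->
     eval s e = encode (f a) /\ eval_time s e <= K * code_size a) ->
  poly_time f.
Proof.
move=> ef.
have KP : poly_bounded (fun a : A => K * code_size a).
  by apply: poly_bounded_mul; [apply: poly_bounded_const|apply: poly_bounded_size].
(* The cost of an expression includes the size of its value, so the time bound also bounds the
   output. *)
have le s : tree_size (eval s e) <= eval_time s e by case: e {ef} => *; apply: leq_addr.
split.
  apply: poly_bounded_le KP => a; have [] := ef (fun=> encode a) a erefl.
  by rewrite /code_size => <-; apply: leq_trans.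
exists (CAssign 0 e), 1, (fun a => (K * code_size a) + 1); split=> //.
  by apply: poly_bounded_add => //; apply: poly_bounded_const.
move=> a s sa; have [ev et] := ef s a sa.
apply: runs_weaken (runs_assign (Q := fun s' =>
  s' 0 = encode (f a) /\ forall x, 1 <= x -> s' x = s x) _) _ _ => //; last by lia.
by split=> [|x x1]; simpl_store.
Qed.

Lemma poly_time_comp (g : B -> C) (f : A -> B) :
  poly_time g -> poly_time f -> poly_time (fun a => g (f a)).
Proof.
case=> gs [c2 [m2 [T2 [TP2 m20 cg]]]] [fs [c1 [m1 [T1 [TP1 m10 cf]]]]]; split.
  exact: (poly_bounded_comp fs gs).
exists (CSeq c1 c2), (m1 + m2), (fun a => T1 a + T2 (f a) + 1); split; last 1 first.
- move=> a s sa; rewrite addn1; apply: runs_seq.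
  apply: runs_weaken (cf a s sa) (leqnn _) _ => s1 [s1a e1].
  apply: runs_weaken (cg _ s1 s1a) (leqnn _) _ => s2 [s2a e2].
  by split=> // x xm; rewrite e2 ?e1 //; lia.
- apply: poly_bounded_add (poly_bounded_const _); apply: poly_bounded_add => //.
  exact: poly_bounded_comp TP2.
- by lia.
Qed.

Lemma poly_time_pair (f : A -> B) (g : A -> C) :
  poly_time f -> poly_time g -> poly_time (fun a => (f a, g a)).
Proof.
case=> fs [c1 [m1 [T1 [TP1 m10 cf]]]] [gs [c2 [m2 [T2 [TP2 m20 cg]]]]]; split.
  apply: (@poly_bounded_le _ _ _ (fun a => code_size (f a) + code_size (g a) + 1)).
    by move=> a; rewrite code_size_pair addn1.
  by apply: poly_bounded_add (poly_bounded_const _); apply: poly_bounded_add.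
(* [M] and [M.+1] lie beyond the scratch space of both programs; they save the input and the first
   component. *)
set M := m1 + m2.
exists (CSeq (CAssign M (EVar 0)) (CSeq c1 (CSeq (CAssign M.+1 (EVar 0))
  (CSeq (CAssign 0 (EVar M)) (CSeq c2 (CAssign 0 (ENode (EVar M.+1) (EVar 0)))))))).
exists M.+2, (fun a =>
  T1 a + T2 a + (2 * code_size a + 3 * code_size (f a) + 2 * code_size (g a)) + 10).
split=> //; last first.
- move=> a s sa.
  apply: (@runs_weaken _ _ ((code_size a).+1 + (T1 a + ((code_size (f a)).+1 +
      ((code_size a).+1 +
      (T2 a + (2 * code_size (f a) + 2 * code_size (g a) + 2)).+1).+1).+1).+1).+1 _
    (fun s' => s' 0 = encode (f a, g a) /\ (forall x, M.+1 < x -> s' x = s x)));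
    [|lia|by []].
  apply: runs_seq; apply: runs_weaken (runs_assign _) _ (fun _ p => p); last first.
    by rewrite /= sa /code_size; lia.
  apply: runs_seq; apply: runs_weaken (@cf a _ _) (leqnn _) _ => [|s1 [s1a e1]].
    by simpl_store.
  apply: runs_seq; apply: runs_weaken (runs_assign _) _ (fun _ p => p); last first.
    by rewrite /= s1a /code_size; lia.
  have s1M : s1 M = encode a by rewrite e1; [simpl_store|lia].
  apply: runs_seq; apply: runs_weaken (runs_assign _) _ (fun _ p => p); last first.
    by simpl_store; rewrite s1M /code_size; lia.
  apply: runs_seq; apply: runs_weaken (@cg a _ _) (leqnn _) _ => [|s2 [s2a e2]].
    by simpl_store.
  have s2M : s2 M.+1 = encode (f a) by rewrite e2; [simpl_store|lia].
  apply: runs_weaken (runs_assign _) _ (fun _ p => p); last first.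
    by rewrite /= s2a s2M /code_size; lia.
  split; first by simpl_store; rewrite s2a s2M.
  move=> x xM; simpl_store; rewrite e2; last by lia.
  by simpl_store; rewrite e1; [simpl_store|lia].
- do ?[apply: poly_bounded_add|apply: poly_bounded_mul] => //;
  by do ?[apply: poly_bounded_const|apply: poly_bounded_size].
Qed.

(** Testing whether a code is a node covers both booleans and zero tests on numbers. *)
Lemma poly_time_if_node (b : A -> B) (f g h : A -> C) :
  (forall a, h a = if is_node (encode (b a)) then f a else g a) ->
  poly_time b -> poly_time f -> poly_time g -> poly_time h.
Proof.
move=> hE [bs [c0 [m0 [T0 [TP0 m00 cb]]]]] [fs [c1 [m1 [T1 [TP1 m10 cf]]]]].
case=> gs [c2 [m2 [T2 [TP2 m20 cg]]]]; split.
  apply: (@poly_bounded_le _ _ _ (fun a => code_size (f a) + code_size (g a))).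
    by move=> a; rewrite hE; case: ifP => _; lia.
  by apply: poly_bounded_add.
set M := m0 + m1 + m2.
exists (CSeq (CAssign M (EVar 0)) (CSeq c0 (CSeq (CAssign M.+1 (EVar 0))
  (CSeq (CAssign 0 (EVar M)) (CIf (EVar M.+1) c1 c2))))).
exists M.+2, (fun a => T0 a + T1 a + T2 a + (2 * code_size a + 2 * code_size (b a)) + 10).
split=> //; last first.
- move=> a s sa.
  apply: (@runs_weaken _ _ ((code_size a).+1 + (T0 a + ((code_size (b a)).+1 +
      ((code_size a).+1 + (code_size (b a) + (T1 a + T2 a)).+1).+1).+1).+1).+1 _
    (fun s' => s' 0 = encode (h a) /\ (forall x, M.+1 < x -> s' x = s x)));
    [|lia|by []].
  apply: runs_seq; apply: runs_weaken (runs_assign _) _ (fun _ p => p); last first.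
    by rewrite /= sa /code_size; lia.
  apply: runs_seq; apply: runs_weaken (@cb a _ _) (leqnn _) _ => [|s1 [s1a e1]].
    by simpl_store.
  apply: runs_seq; apply: runs_weaken (runs_assign _) _ (fun _ p => p); last first.
    by rewrite /= s1a /code_size; lia.
  have s1M : s1 M = encode a by rewrite e1; [simpl_store|lia].
  apply: runs_seq; apply: runs_weaken (runs_assign _) _ (fun _ p => p); last first.
    by simpl_store; rewrite s1M /code_size; lia.
  apply: runs_weaken (runs_if (b := T1 a + T2 a) _) _ (fun _ p => p); last first.
    by simpl_store; rewrite s1a /code_size; lia.
  simpl_store; rewrite s1a hE s1M.
  case: (is_node _).
  + apply: runs_weaken (@cf a _ _) _ _; [by simpl_store|lia|].
    move=> s2 [-> e2]; split=> // x xM; rewrite e2; last by lia.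
    by simpl_store; rewrite e1; [simpl_store|lia].
  + apply: runs_weaken (@cg a _ _) _ _; [by simpl_store|lia|].
    move=> s2 [-> e2]; split=> // x xM; rewrite e2; last by lia.
    by simpl_store; rewrite e1; [simpl_store|lia].
- do ?[apply: poly_bounded_add|apply: poly_bounded_mul] => //;
  by do ?[apply: poly_bounded_const|apply: poly_bounded_size].
Qed.
End Combinators.

Section Access.
Context {A B : Type} {eA : encodable A} {eB : encodable B}.

Lemma poly_time_id : poly_time (fun a : A => a).
Proof.
apply: (@poly_time_expr _ _ _ _ _ (EVar 0) 1) => s a sa.
by rewrite /= sa /code_size; split=> //; lia.
Qed.

Lemma poly_time_left (f : A -> B) :
  (forall a, encode (f a) = left_tree (encode a)) -> poly_time f.
Proof.
move=> fE; apply: (@poly_time_expr _ _ _ _ _ (ELeft (EVar 0)) 2) => s a sa.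
rewrite /= sa fE /code_size; split=> //; case: (encode a) => //= l r; lia.
Qed.

Lemma poly_time_right (f : A -> B) :
  (forall a, encode (f a) = right_tree (encode a)) -> poly_time f.
Proof.
move=> fE; apply: (@poly_time_expr _ _ _ _ _ (ERight (EVar 0)) 2) => s a sa.
rewrite /= sa fE /code_size; split=> //; case: (encode a) => //= l r; lia.
Qed.

Lemma poly_time_const (b : B) : poly_time (fun _ : A => b).
Proof.
have [e [K eK]] : exists e K, forall s, eval s e = encode b /\ eval_time s e <= K.
  elim: (encode b) => [|l [el [Kl IHl]] r [er [Kr IHr]]]; first by exists ELeaf, 1.
  exists (ENode el er), (tree_size (node l r) + Kl + Kr) => s /=.
  by have [-> ?] := IHl s; have [-> ?] := IHr s; split=> //; lia.
apply: (@poly_time_expr _ _ _ _ _ e K) => s a _; have [-> eb] := eK s.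
by split=> //; rewrite (leq_trans eb) // leq_pmulr // code_size_gt0.
Qed.
End Access.

Lemma poly_time_fst A B C {eA : encodable A} {eB : encodable B} {eC : encodable C}
  (f : A -> B * C) : poly_time f -> poly_time (fun a => (f a).1).
Proof. by apply: (poly_time_comp (g := fst)); apply: poly_time_left. Qed.

Lemma poly_time_snd A B C {eA : encodable A} {eB : encodable B} {eC : encodable C}
  (f : A -> B * C) : poly_time f -> poly_time (fun a => (f a).2).
Proof. by apply: (poly_time_comp (g := snd)); apply: poly_time_right. Qed.

Lemma poly_time_cons A B {eA : encodable A} {eB : encodable B}
    (f : A -> B) (g : A -> seq B) :
  poly_time f -> poly_time g -> poly_time (fun a => f a :: g a).
Proof.
move=> fP gP; apply: (poly_time_code (g := fun a => (f a, g a))) => //.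
exact: poly_time_pair.
Qed.

Lemma poly_time_behead A B {eA : encodable A} {eB : encodable B}
  (f : A -> seq B) : poly_time f -> poly_time (fun a => behead (f a)).
Proof. by apply: (poly_time_comp (g := behead)); apply: poly_time_right => -[]. Qed.

Lemma poly_time_if A B {eA : encodable A} {eB : encodable B}
    (b : A -> bool) (f g : A -> B) :
  poly_time b -> poly_time f -> poly_time g ->
  poly_time (fun a => if b a then f a else g a).
Proof. by apply: poly_time_if_node => a; case: (b a). Qed.

(** * Folds whose accumulator grows additively *)

Section Fold.
Context {E X A : Type} {eE : encodable E} {eX : encodable X} {eA : encodable A}.
Variables (l : E -> seq X) (i : E -> A) (g : E -> A -> X -> A) (h : E * X -> nat).

(* Bounded recursion: without [growth] the size of the accumulator could be
   squared at each step. *)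
Hypothesis growth :
  forall e a x, code_size (g e a x) <= code_size a + h (e, x).
Hypothesis hP : poly_bounded h.

(** This is [(code_size (e, x) + 2) ^ k] with the size of the list in place of that of its element
    [x]; the pair node accounts for the 3. *)
Let bound k e := (code_size e + code_size (l e) + 3) ^ k.

Let poly_bounded_bound k :
  poly_bounded (fun e => code_size (l e)) -> poly_bounded (bound k).
Proof.
move=> lP; apply/poly_bounded_exp/poly_bounded_add; last exact: poly_bounded_const.
by apply: poly_bounded_add => //; apply: poly_bounded_size.
Qed.

Lemma code_size_foldl e H a s :
  (forall x, code_size x <= code_size s -> h (e, x) <= H) ->
  code_size (foldl (g e) a s) <= code_size a + size s * H.
Proof.
elim: s a => [|x s IH] a hs /=; first by lia.
apply: leq_trans (IH _ _) _.
  by move=> y ys; apply: hs; rewrite code_size_cons; lia.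
have := growth e a x; have := hs x; rewrite code_size_cons; lia.
Qed.

(** Variable [M] holds the environment, [M.+1] the rest of the list and [M.+2] the accumulator; each
    turn assembles the argument of [c] in variable 0. *)
Definition fold_loop M c :=
  CWhile (EVar M.+1)
    (CSeq (CAssign 0 (ENode (EVar M) (ENode (EVar M.+2) (ELeft (EVar M.+1)))))
    (CSeq c (CSeq (CAssign M.+2 (EVar 0)) (CAssign M.+1 (ERight (EVar M.+1)))))).

(** Every turn is charged the same cost, with [L] bounding the list and [Z] the accumulator. The
    hypothesis on [Z] reserves [H] for each remaining element, which makes it stable under the
    induction; the extra turn in the bound pays for the last test. *)
Lemma runs_fold_loop c m M T e H L K Z xs a s :
    computes (fun p : E * (A * X) => g p.1 p.2.1 p.2.2) c m T ->
    0 < m -> m <= M -> s M = encode e -> s M.+1 = encode xs -> s M.+2 = encode a ->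
    (forall x, code_size x <= L -> h (e, x) <= H) -> code_size xs <= L ->
    code_size a + size xs * H <= Z ->
    (forall b x, code_size b <= Z -> code_size x <= L -> T (e, (b, x)) <= K) ->
  runs (fold_loop M c) s
    ((size xs).+1 * (K + 6 * (code_size e + L + Z) + 20))
    (fun s' => [/\ s' M.+2 = encode (foldl (g e) a xs) &
       forall x, M.+2 < x -> s' x = s x]).
Proof.
move=> cg m0 mM sM sM1 sM2 hH xsL aZ TK.
elim: xs a s sM sM1 sM2 xsL aZ => [|x xs IH] a s sM sM1 sM2 xsL aZ.
  apply: runs_weaken (runs_while_done _ _ _) _ (fun _ p => p); last first.
  - by rewrite /= sM1 /=; lia.
  - by split=> //; rewrite sM2.
  - by rewrite /= sM1.
rewrite code_size_cons in xsL; rewrite /= in aZ.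
have hx : h (e, x) <= H by apply: hH; lia.
have ag := growth e a x.
have x0 := code_size_gt0 x; have xs0 := code_size_gt0 xs.
apply: (@runs_weaken _ _ (L + (K + 5 * (code_size e + L + Z) + 17) +
   (size xs).+1 * (K + 6 * (code_size e + L + Z) + 20)).+1 _
   (fun s' => [/\ s' M.+2 = encode (foldl (g e) a (x :: xs)) &
      forall y, M.+2 < y -> s' y = s y])); [|by rewrite /=; lia|by []].
have ex : encode (x :: xs) = node (encode x) (encode xs) by [].
rewrite {1}/fold_loop; apply: runs_weaken (@runs_while_step _ _ _
   (K + 5 * (code_size e + L + Z) + 17)
   ((size xs).+1 * (K + 6 * (code_size e + L + Z) + 20)) _ _ _) _ (fun _ p => p);
  last first.
- by rewrite /= sM1 ex /= -/(code_size x) -/(code_size xs); lia.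
- apply: runs_weaken (runs_seq
    (b1 := 2 * code_size e + 3 * code_size a + 4 * code_size x + code_size xs + 6)
    (b2 := (K + (code_size (g e a x) + code_size x + 2 * code_size xs + 6)).+1) _) _
    (fun _ p => p); last by lia.
  apply: runs_weaken (runs_assign _) _ (fun _ p => p); last first.
    rewrite /= sM sM1 sM2 ex /= -/(code_size x) -/(code_size xs) -/(code_size a).
    by rewrite -/(code_size e); lia.
  apply: runs_seq.
  apply: runs_weaken (@cg (e, (a, x)) _ _) _ _; [|by apply: TK; lia|].
    by rewrite /= sM sM1 sM2; simpl_store.
  rewrite /=; move=> s1 [s10 e1].
  have s1M1 : s1 M.+1 = encode (x :: xs) by rewrite e1; [simpl_store; rewrite sM1|lia].
  apply: runs_weaken (runs_seq (b1 := code_size (g e a x) + 2)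
    (b2 := code_size x + 2 * code_size xs + 3) _) _ (fun _ p => p); last by lia.
  apply: runs_weaken (runs_assign _) _ (fun _ p => p); last first.
    by rewrite /= s10 /code_size; lia.
  apply: runs_weaken (runs_assign _) _ (fun _ p => p); last first.
    by simpl_store; rewrite s1M1 ex /= /code_size; lia.
  apply: runs_weaken (IH (g e a x) _ _ _ _ _ _) _ _ => //; try by lia.
  - by simpl_store; rewrite e1 //; simpl_store.
  - by simpl_store; rewrite s1M1.
  - by simpl_store.
  - move=> s2 [-> e2]; split=> // y yM; rewrite e2 //; simpl_store.
    by rewrite e1; [simpl_store|lia].
- by rewrite /= sM1 ex.
Qed.

(** Additive growth keeps every intermediate accumulator below the polynomial [Z e], so the body
    always runs on arguments of polynomial size. *)
Lemma poly_time_foldl :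
  poly_time l -> poly_time i ->
  poly_time (fun p : E * (A * X) => g p.1 p.2.1 p.2.2) ->
  poly_time (fun e => foldl (g e) (i e) (l e)).
Proof.
case=> ls [c0 [m0 [T0 [TP0 m00 cl]]]] [is_ [c1 [m1 [T1 [TP1 m10 ci]]]]].
case=> gs [c2 [m2 [T2 [[k TP2] m20 cg]]]]; have [kh hk] := hP.
pose H := bound kh.
have HP : poly_bounded H by apply: poly_bounded_bound.
have hH e x : code_size x <= code_size (l e) -> h (e, x) <= H e.
  move=> xl; apply: leq_trans (hk _) _; rewrite /H /bound code_size_pair.
  by case: (kh) => // n; rewrite leq_exp2r //; lia.
pose L e := @code_size _ (encodable_seq eX) (l e).
pose Z e := @code_size _ eA (i e) + L e * H e.
have ZP : poly_bounded Z by apply: poly_bounded_add => //; apply: poly_bounded_mul.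
(* The 4 adds the two pair nodes of [(e, (b, x))] to the 2 of [poly_bounded]. *)
pose K e := (@code_size _ eE e + Z e + L e + 4) ^ k.
have KP : poly_bounded K.
  apply/poly_bounded_exp/poly_bounded_add; last exact: poly_bounded_const.
  do ?apply: poly_bounded_add => //; exact: poly_bounded_size.
have sizeL e : size (l e) < L e by apply: size_code_size.
split.
  apply: poly_bounded_le ZP => e; apply: leq_trans (code_size_foldl (H := H e) _ _) _.
    exact: hH.
  by rewrite /Z leq_add2l leq_mul // ltnW.
set M := m0 + m1 + m2.
exists (CSeq (CAssign M (EVar 0)) (CSeq c0 (CSeq (CAssign M.+1 (EVar 0))
  (CSeq (CAssign 0 (EVar M)) (CSeq c1 (CSeq (CAssign M.+2 (EVar 0))
  (CSeq (fold_loop M c2) (CAssign 0 (EVar M.+2))))))))).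
exists M.+3, (fun e => 2 * code_size e + T0 e + L e + T1 e + 2 * Z e +
  L e * (K e + 6 * (code_size e + L e + Z e) + 20) + 20).
split=> //; last first.
- move=> e s se.
  apply: (@runs_weaken _ _ ((code_size e).+1 + (T0 e + ((L e).+1 +
      ((code_size e).+1 + (T1 e + ((code_size (i e)).+1 +
      (L e * (K e + 6 * (code_size e + L e + Z e) + 20) +
      (Z e).+1).+1).+1).+1).+1).+1).+1).+1 _
    (fun s' => s' 0 = encode (foldl (g e) (i e) (l e)) /\
       (forall x, M.+2 < x -> s' x = s x))); [|by rewrite /Z; lia|by []].
  apply: runs_seq; apply: runs_weaken (runs_assign _) _ (fun _ p => p); last first.
    by rewrite /= se /code_size; lia.
  apply: runs_seq; apply: runs_weaken (@cl e _ _) (leqnn _) _ => [|s1 [s1a e1]].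
    by simpl_store.
  apply: runs_seq; apply: runs_weaken (runs_assign _) _ (fun _ p => p); last first.
    by rewrite /= s1a /L /code_size; lia.
  have s1M : s1 M = encode e by rewrite e1; [simpl_store|lia].
  apply: runs_seq; apply: runs_weaken (runs_assign _) _ (fun _ p => p); last first.
    by simpl_store; rewrite s1M /code_size; lia.
  apply: runs_seq; apply: runs_weaken (@ci e _ _) (leqnn _) _ => [|s2 [s2a e2]].
    by simpl_store.
  apply: runs_seq; apply: runs_weaken (runs_assign _) _ (fun _ p => p); last first.
    by rewrite /= s2a /code_size; lia.
  apply: runs_seq.
  apply: runs_weaken (@runs_fold_loop c2 m2 M T2 e (H e) (L e) (K e) (Z e) (l e)
    (i e) _ cg m20 _ _ _ _ _ _ _ _) _ _ => //.
  + by lia.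
  + by simpl_store; rewrite e2; [simpl_store|lia].
  + by simpl_store; rewrite e2; [simpl_store|lia].
  + by simpl_store.
  + exact: hH.
  + by rewrite /Z leq_add2l leq_mul // ltnW.
  + move=> b x bZ xL; apply: leq_trans (TP2 _) _; rewrite !code_size_pair.
    rewrite /K; case: (k) => // n; rewrite leq_exp2r //; lia.
  + by rewrite leq_mul.
  + move=> s3 [s3a e3].
    apply: runs_weaken (runs_assign _) _ (fun _ p => p); last first.
      rewrite /= s3a addn0 ltnS -/(code_size (foldl (g e) (i e) (l e))).
      apply: leq_trans (code_size_foldl (H := H e) _ _) _; first exact: hH.
      by rewrite /Z leq_add2l leq_mul // ltnW.
    split; first by simpl_store.
    move=> x xM; simpl_store; rewrite e3 //; simpl_store; rewrite e2; last by lia.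
    by simpl_store; rewrite e1; [simpl_store|lia].
- have sP := @poly_bounded_size E eE.
  do ?[apply: poly_bounded_add|apply: poly_bounded_mul] => //;
  by do ?[apply: poly_bounded_const].
Qed.
End Fold.

Ltac poly_time_access := cbv beta; repeat match goal with
  | H : @poly_time _ _ _ _ ?f |- @poly_time _ _ _ _ ?f => exact: H
  | |- @poly_time _ _ _ _ (fun x => x) => exact: poly_time_id
  | |- @poly_time _ _ _ _ (@fst _ _) => exact: poly_time_left
  | |- @poly_time _ _ _ _ (@snd _ _) => exact: poly_time_right
  | |- @poly_time _ _ _ _ (fun x => fst (@?f x)) => apply: (@poly_time_fst _ _ _ _ _ _ f)
  | |- @poly_time _ _ _ _ (fun x => snd (@?f x)) => apply: (@poly_time_snd _ _ _ _ _ _ f)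
  | |- @poly_time _ _ _ _ (fun x => behead (@?f x)) => apply: (poly_time_behead (f := f))
  | |- @poly_time _ _ _ _ (fun x => (@?f x, @?g x)) =>
      apply: (poly_time_pair (f := f) (g := g))
  | |- @poly_time _ _ _ _ (fun x => @?f x :: @?g x) =>
      apply: (poly_time_cons (f := f) (g := g))
  end.

Lemma poly_time_ext E A {eE : encodable E} {eA : encodable A} (f g : E -> A) :
  f =1 g -> poly_time g -> poly_time f.
Proof. by move=> fg; apply: poly_time_code => a; rewrite fg. Qed.

(** * Polynomial-time operations on lists *)

Section Lists.
Context {E X A : Type}.
Context {eE : encodable E} {eX : encodable X} {eA : encodable A}.

Lemma poly_time_rev (l : E -> seq X) : poly_time l -> poly_time (fun e => rev (l e)).
Proof.
move=> lP.
apply: (poly_time_ext (g := fun e => foldl (fun s x => x :: s) [::] (l e))) => [e|].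
  by rewrite /rev; elim: (l e) [::] => //= x s IH t; rewrite -IH.
apply: (poly_time_foldl (i := fun=> [::]) (g := fun _ s x => x :: s)
  (h := fun p => code_size p.2 + 1)) => //.
- by move=> e s x; rewrite code_size_cons /=; lia.
- apply: poly_bounded_add (poly_bounded_const _).
  by apply: poly_bounded_le poly_bounded_size => p; rewrite [code_size p]code_size_pair; lia.
- exact: poly_time_const.
- by poly_time_access.
Qed.

Lemma poly_time_foldr (l : E -> seq X) (i : E -> A) (g : E -> X -> A -> A)
    (h : E * X -> nat) :
  (forall e x a, code_size (g e x a) <= code_size a + h (e, x)) -> poly_bounded h ->
  poly_time l -> poly_time i ->
  poly_time (fun p : E * (A * X) => g p.1 p.2.2 p.2.1) ->
  poly_time (fun e => foldr (g e) (i e) (l e)).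
Proof.
move=> gh hP lP iP gP.
apply: (poly_time_ext (g := fun e => foldl (fun a x => g e x a) (i e) (rev (l e)))) => [e|].
  by rewrite foldl_rev.
by apply: (poly_time_foldl (g := fun e a x => g e x a) (h := h)) => //; apply: poly_time_rev.
Qed.

Lemma poly_bounded_snd (h : X -> nat) :
  poly_bounded h -> poly_bounded (fun p : E * X => h p.2).
Proof.
move=> hP; apply: (@poly_bounded_comp _ _ _ _ snd h _ hP).
by apply: poly_bounded_le poly_bounded_size => p; rewrite [code_size p]code_size_pair; lia.
Qed.

End Lists.

Lemma poly_time_negb E {eE : encodable E} (f : E -> bool) :
  poly_time f -> poly_time (fun e => ~~ f e).
Proof.
by move=> fP; apply: poly_time_if => //; apply: poly_time_const.
Qed.

Section Lists2.
Context {E X Y : Type}.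
Context {eE : encodable E} {eX : encodable X} {eY : encodable Y}.

Lemma poly_time_map (l : E -> seq X) (f : E -> X -> Y) :
  poly_time l -> poly_time (fun p : E * X => f p.1 p.2) ->
  poly_time (fun e => [seq f e x | x <- l e]).
Proof.
move=> lP fP; have [fs _] := fP.
apply: (poly_time_foldr (i := fun=> [::]) (g := fun e x s => f e x :: s)
  (h := fun p => code_size (f p.1 p.2) + 1)) => //.
- by move=> e x s; rewrite code_size_cons /=; lia.
- exact: poly_bounded_add (poly_bounded_const _).
- exact: poly_time_const.
- apply: poly_time_cons; last by poly_time_access.
  apply: (poly_time_comp (g := fun p : E * X => f p.1 p.2)
    (f := fun p : E * (seq Y * X) => (p.1, p.2.2))) => //.
  by poly_time_access.
Qed.

Lemma poly_time_filter (l : E -> seq X) (f : E -> X -> bool) :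
  poly_time l -> poly_time (fun p : E * X => f p.1 p.2) ->
  poly_time (fun e => [seq x <- l e | f e x]).
Proof.
move=> lP fP.
apply: (poly_time_foldr (i := fun=> [::]) (g := fun e x s => if f e x then x :: s else s)
  (h := fun p => code_size p.2 + 1)) => //.
- by move=> e x s; case: ifP => _; rewrite ?code_size_cons /=; lia.
- apply: (poly_bounded_snd (h := fun x => code_size x + 1)).
  exact: poly_bounded_add poly_bounded_size (poly_bounded_const _).
- exact: poly_time_const.
- apply: poly_time_if; [|by poly_time_access|by poly_time_access].
  apply: (poly_time_comp (g := fun p : E * X => f p.1 p.2)
    (f := fun p : E * (seq X * X) => (p.1, p.2.2))) => //.
  by poly_time_access.
Qed.

Lemma poly_time_has (l : E -> seq X) (f : E -> X -> bool) :
  poly_time l -> poly_time (fun p : E * X => f p.1 p.2) ->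
  poly_time (fun e => has (f e) (l e)).
Proof.
move=> lP fP.
apply: (poly_time_ext (g := fun e =>
  foldr (fun x b => if f e x then true else b) false (l e))) => [e|].
  by elim: (l e) => //= x s <-.
(* The growth bound 3 is the size of the code of [true]. *)
apply: (poly_time_foldr (i := fun=> false) (g := fun e x b => if f e x then true else b)
  (h := fun=> 3)) => //.
- by move=> e x s; case: ifP => _; rewrite /code_size /=; lia.
- exact: poly_bounded_const.
- exact: poly_time_const.
- apply: poly_time_if; [|exact: poly_time_const|by poly_time_access].
  apply: (poly_time_comp (g := fun p : E * X => f p.1 p.2)
    (f := fun p : E * (bool * X) => (p.1, p.2.2))) => //.
  by poly_time_access.
Qed.

Lemma poly_time_all (l : E -> seq X) (f : E -> X -> bool) :
  poly_time l -> poly_time (fun p : E * X => f p.1 p.2) ->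
  poly_time (fun e => all (f e) (l e)).
Proof.
move=> lP fP.
apply: (poly_time_ext (g := fun e => ~~ has (fun x => ~~ f e x) (l e))) => [e|].
  by rewrite -all_predC; apply: eq_all => x /=; rewrite negbK.
apply: poly_time_negb; apply: (poly_time_has (f := fun e x => ~~ f e x)) => //.
exact: poly_time_negb.
Qed.

Lemma code_size_cat (s t : seq X) : code_size (s ++ t) < code_size s + code_size t.
Proof. by elim: s => [|x s IH] //=; rewrite !code_size_cons; lia. Qed.

Lemma poly_time_cat (f g : E -> seq X) :
  poly_time f -> poly_time g -> poly_time (fun e => f e ++ g e).
Proof.
move=> fP gP.
apply: (poly_time_ext (g := fun e => foldr (fun x s => x :: s) (g e) (f e))) => [e|].
  by elim: (f e) => //= x s ->.
apply: (poly_time_foldr (g := fun _ x s => x :: s) (h := fun p => code_size p.2 + 1)) => //.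
- by move=> e x s; rewrite code_size_cons /=; lia.
- apply: (poly_bounded_snd (h := fun x => code_size x + 1)).
  exact: poly_bounded_add poly_bounded_size (poly_bounded_const _).
- by poly_time_access.
Qed.
End Lists2.

Lemma poly_time_flatten E X {eE : encodable E} {eX : encodable X} (f : E -> seq (seq X)) :
  poly_time f -> poly_time (fun e => flatten (f e)).
Proof.
move=> fP.
apply: (poly_time_foldr (i := fun=> [::]) (g := fun _ s t => s ++ t)
  (h := fun p => code_size p.2)) => //.
- by move=> e s t /=; rewrite addnC ltnW // code_size_cat.
- exact: (poly_bounded_snd (h := @code_size _ _) poly_bounded_size).
- exact: poly_time_const.
- by apply: poly_time_cat; poly_time_access.
Qed.

(** * Arithmetic on unary numbers *)

Section Nat.
Context {E : Type} {eE : encodable E}.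
Implicit Types m n : E -> nat.

Lemma encode_nseq_tt (n : nat) : encode (nseq n tt) = encode n.
Proof. by rewrite /encode /encodable_seq map_nseq. Qed.

(** A unary number, read as a list of units, serves as a loop counter for the predecessor, which is
    the right subtree. *)
Lemma poly_time_subn m n : poly_time m -> poly_time n -> poly_time (fun e => m e - n e).
Proof.
move=> mP nP.
apply: (poly_time_ext (g := fun e => foldl (fun k _ => k.-1) (m e) (nseq (n e) tt))) => [e|].
  by elim: (n e) (m e) => [|k IH] j /=; rewrite ?subn0 // -IH; lia.
apply: (poly_time_foldl (l := fun e => nseq (n e) tt) (g := fun _ k _ => k.-1)
  (h := fun=> 0)) => //.
- by move=> e [|k] x //=; rewrite addn0; apply: (leq_addl 2 (code_size k)).
- exact: poly_bounded_const.
- by apply: poly_time_code nP => e; apply: encode_nseq_tt.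
- apply: (poly_time_comp (g := predn) (f := fun p : E * (nat * unit) => p.2.1)).
    by apply: poly_time_right => -[].
  by poly_time_access.
Qed.

Lemma poly_time_eqn m n : poly_time m -> poly_time n -> poly_time (fun e => m e == n e).
Proof.
move=> mP nP.
(* Trees cannot be compared by a primitive test, so order is decided by whether the truncated
   difference is zero, and equality by two such tests. *)
have leP p q : poly_time p -> poly_time q -> poly_time (fun e => p e <= q e).
  move=> pP qP; apply: (poly_time_if_node (b := fun e => p e - q e)
      (f := fun=> false) (g := fun=> true)).
  - by move=> e; rewrite /leq; case: (p e - q e).
  - exact: poly_time_subn.
  - exact: poly_time_const.
  - exact: poly_time_const.
apply: (poly_time_ext (g := fun e => if m e <= n e then n e <= m e else false)) => [e|].
  by rewrite eqn_leq.
by apply: poly_time_if; [apply: leP|apply: leP|apply: poly_time_const].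
Qed.

End Nat.

Lemma poly_time_mem E {eE : encodable E} (x : E -> nat) (s : E -> seq nat) :
  poly_time x -> poly_time s -> poly_time (fun e => x e \in s e).
Proof.
move=> xP sP.
apply: (poly_time_ext (g := fun e => has (fun y => x e == y) (s e))) => [e|].
  by elim: (s e) => //= y t <-; rewrite in_cons.
apply: (poly_time_has (f := fun e y => x e == y)) => //.
apply: poly_time_eqn; last by poly_time_access.
by apply: (poly_time_comp xP (f := fst)); poly_time_access.
Qed.

Lemma poly_time_iter E X A {eE : encodable E} {eX : encodable X} {eA : encodable A}
    (l : E -> seq X) (i : E -> A) (f : E -> A -> A) (h : E -> nat) :
  (forall e a, code_size (f e a) <= code_size a + h e) -> poly_bounded h ->
  poly_time l -> poly_time i -> poly_time (fun p : E * A => f p.1 p.2) ->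
  poly_time (fun e => iter (size (l e)) (f e) (i e)).
Proof.
move=> fh hP lP iP fP.
apply: (poly_time_ext (g := fun e => foldl (fun a _ => f e a) (i e) (l e))) => [e|].
  by elim: (l e) (i e) => //= x s IH a; rewrite -IH -iterSr.
apply: (poly_time_foldl (g := fun e a _ => f e a) (h := fun p => h p.1)) => //.
- apply: (@poly_bounded_comp _ _ _ _ fst h _ hP).
  by apply: poly_bounded_le poly_bounded_size => p; rewrite [code_size p]code_size_pair; lia.
- apply: (poly_time_comp (g := fun p : E * A => f p.1 p.2)
    (f := fun p : E * (A * X) => (p.1, p.2.1))) => //.
  by poly_time_access.
Qed.

(** * The algorithm *)

Section Algorithm.
Variable T : eqType.
Implicit Types (V X Y : seq T) (i : seq T * seq T) (S R : seq (seq T * seq T)).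

Definition chain S X Y :=
  X ++ flatten [seq i.2 | i <- [seq i <- S | all (fun x => x \in Y) i.1]].

(** Started from the empty list, the rounds increase as sets; when [V] enumerates the vertices,
    [size V] rounds reach the least fixed point. *)
Definition forward_closure V S X := iter (size V) (chain S X) [::].

Definition delete x X := [seq y <- X | y != x].

(** [P Y x] is meant to say that [x] is recoverable from [Y], where [x] has just been deleted. The
    loop visits the original list while deletions accumulate in [Y]. *)
Definition shrink (P : seq T -> T -> bool) X :=
  foldl (fun Y x => if P (delete x Y) x then delete x Y else Y) X X.

Definition reduce_premise V S A := shrink (fun X x => x \in forward_closure V S X) A.

Definition saturate V S :=
  [seq (reduce_premise V S i.1, [seq x <- V | x \in forward_closure V S i.1]) | i <- S].

Definition reduce_conclusion V R i :=
  (i.1, shrink (fun X x => x \in forward_closure V ((i.1, X) :: R) i.1) i.2).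

(** The state pairs the implications already reduced with the suffix starting at [i]. The fold
    itself passes only [i], so the suffix is carried along and its [behead] holds the implications
    still to come. *)
Definition reduce_step V (st : seq (seq T * seq T) * seq (seq T * seq T)) i :=
  (reduce_conclusion V (st.1 ++ behead st.2) i :: st.1, behead st.2).

Definition reduce_conclusions V S := (foldl (reduce_step V) ([::], S) S).1.

Definition optimize V S :=
  [seq i <- reduce_conclusions V (saturate V S) | has predT i.2].
End Algorithm.

Definition map_implication (T T' : Type) (f : T -> T') (i : seq T * seq T) :=
  (map f i.1, map f i.2).

(** * Invariance of the algorithm under injective renaming *)

Section Naturality.
Variables (T T' : eqType) (f : T -> T').
Hypothesis f_inj : injective f.

Local Notation mapi := (map_implication f).

Lemma map_chain S X Y :
  chain (map mapi S) (map f X) (map f Y) = map f (chain S X Y).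
Proof.
rewrite /chain map_cat map_flatten filter_map -!map_comp; congr (_ ++ flatten _).
rewrite (@eq_filter _ _ (fun i => all (fun x => x \in Y) i.1)) // => i /=.
by rewrite all_map; apply: eq_all => x /=; rewrite mem_map.
Qed.

Lemma map_forward_closure V S X :
  forward_closure (map f V) (map mapi S) (map f X) = map f (forward_closure V S X).
Proof.
rewrite /forward_closure size_map; elim: (size V) => //= n ->.
exact: map_chain.
Qed.

Lemma map_delete x X : delete (f x) (map f X) = map f (delete x X).
Proof.
by rewrite /delete filter_map; congr map; apply: eq_filter => y /=; rewrite (inj_eq f_inj).
Qed.

Lemma map_shrink (P : seq T -> T -> bool) P' X :
  (forall Y x, P' (map f Y) (f x) = P Y x) ->
  shrink P' (map f X) = map f (shrink P X).
Proof.
move=> PP; rewrite /shrink; elim: X {1 3}X => [|x X IH] Y //=.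
by rewrite map_delete PP -IH; case: ifP.
Qed.

Lemma map_saturate V S : saturate (map f V) (map mapi S) = map mapi (saturate V S).
Proof.
rewrite /saturate -!map_comp; apply: eq_map => i; congr (_, _) => /=.
  apply: map_shrink => Y x.
  by rewrite map_forward_closure mem_map.
rewrite filter_map; congr map; apply: eq_filter => x /=.
by rewrite map_forward_closure mem_map.
Qed.

Lemma map_reduce_conclusion V R i :
  reduce_conclusion (map f V) (map mapi R) (mapi i) = mapi (reduce_conclusion V R i).
Proof.
congr (_, _) => /=; apply: map_shrink => Y x.
by rewrite -[_ :: _]/(map mapi ((i.1, Y) :: R)) map_forward_closure mem_map.
Qed.

(** The program computes on ranks while correctness is proved on vertices; the algorithm only
    compares elements for equality, so the two runs correspond. *)
Lemma map_optimize V S : optimize (map f V) (map mapi S) = map mapi (optimize V S).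
Proof.
rewrite /optimize map_saturate /reduce_conclusions.
set S' := saturate V S.
pose mapst (st : seq (seq T * seq T) * seq (seq T * seq T)) :=
  (map mapi st.1, map mapi st.2).
have E s st : foldl (reduce_step (map f V)) (mapst st) (map mapi s)
    = mapst (foldl (reduce_step V) st s).
  elim: s st => //= i s IH st; rewrite -IH; congr foldl.
  by rewrite /reduce_step /= behead_map -map_cat map_reduce_conclusion.
rewrite (E S' ([::], S')) /= filter_map; congr map.
by apply: eq_filter => i /=; rewrite has_map.
Qed.
End Naturality.

(** * Polynomial running time of the algorithm *)

Section Size.
Context {X : Type} {eX : encodable X}.

Lemma code_size_filter (p : pred X) s : code_size [seq x <- s | p x] <= code_size s.
Proof. by elim: s => //= x s IH; case: ifP; rewrite !code_size_cons; lia. Qed.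

Lemma code_size_behead (s : seq X) : code_size (behead s) <= code_size s.
Proof. by case: s => //= x s; rewrite code_size_cons; lia. Qed.
End Size.

Lemma code_size_shrink (P : seq nat -> nat -> bool) s :
  code_size (shrink P s) <= code_size s.
Proof.
rewrite /shrink; elim: s {1 3}s => //= x s IH t.
apply: leq_trans (IH _) _; case: ifP => // _; exact: code_size_filter.
Qed.

Local Notation imp := (seq nat * seq nat)%type.

Section PolyTime.
Context {E : Type} {eE : encodable E}.
Variables (V : E -> seq nat) (S : E -> seq imp) (X : E -> seq nat).
Hypotheses (VP : poly_time V) (SP : poly_time S) (XP : poly_time X).

Lemma poly_time_chain (Y : E -> seq nat) :
  poly_time Y -> poly_time (fun e => chain (S e) (X e) (Y e)).
Proof.
move=> YP; apply: poly_time_cat => //; apply: poly_time_flatten.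
apply: (poly_time_map (f := fun _ i => i.2)); last by poly_time_access.
apply: (poly_time_filter (f := fun e i => all (fun x => x \in Y e) i.1)) => //.
apply: (poly_time_all (f := fun p x => x \in Y p.1)); first by poly_time_access.
apply: poly_time_mem; first by poly_time_access.
by apply: (poly_time_comp YP (f := fun p => p.1.1)); poly_time_access.
Qed.
End PolyTime.

Lemma poly_time_forward_closure E {eE : encodable E} (V : E -> seq nat)
    (S : E -> seq imp) (X : E -> seq nat) :
  poly_time V -> poly_time S -> poly_time X ->
  poly_time (fun e => forward_closure (V e) (S e) (X e)).
Proof.
move=> VP SP XP.
apply: (poly_time_iter (i := fun=> [::]) (f := fun e => chain (S e) (X e))
  (h := fun e => code_size (X e) + code_size (S e))) => //.
(* The current value [Y] is only read: the result consists of [X] and fired conclusions, so its size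
   is bounded independently of [Y]. *)
- move=> e Y; apply: leq_trans (leq_addl _ _); rewrite /chain.
  apply: leq_trans (ltnW (code_size_cat _ _)) _; rewrite leq_add2l.
  elim: (S e) => //= -[a b] s IH; rewrite code_size_cons code_size_pair /=.
  case: ifP => _ /=; last by lia.
  apply: leq_trans (ltnW (code_size_cat _ _)) _; by lia.
- by apply: poly_bounded_add; [case: XP|case: SP].
- exact: poly_time_const.
- apply: (poly_time_comp (g := fun p : seq imp * seq nat * seq nat => chain p.1.1 p.1.2 p.2)
    (f := fun p => (S p.1, X p.1, p.2))).
    by apply: poly_time_chain; poly_time_access.
  poly_time_access; first by apply: (poly_time_comp SP (f := fst)); poly_time_access.
  by apply: (poly_time_comp XP (f := fst)); poly_time_access.
Qed.

Lemma poly_time_shrink E {eE : encodable E} (P : E -> seq nat -> nat -> bool)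
    (s : E -> seq nat) :
  poly_time s -> poly_time (fun p : E * (seq nat * nat) => P p.1 p.2.1 p.2.2) ->
  poly_time (fun e => shrink (P e) (s e)).
Proof.
move=> sP PP.
pose d (p : E * (seq nat * nat)) := delete p.2.2 p.2.1.
have dP : poly_time d.
  apply: (poly_time_filter (f := fun p y => y != p.2.2)); first by poly_time_access.
  by apply: poly_time_negb; apply: poly_time_eqn; poly_time_access.
apply: (poly_time_foldl (h := fun=> 0)
  (g := fun e Y x => if P e (delete x Y) x then delete x Y else Y)) => //.
- move=> e Y x; rewrite addn0; case: ifP => // _; exact: code_size_filter.
- exact: poly_bounded_const.
- apply: (poly_time_if (f := d)) => //; last by poly_time_access.
  apply: (poly_time_comp (g := fun p : E * (seq nat * nat) => P p.1 p.2.1 p.2.2)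
    (f := fun p => (p.1, (d p, p.2.2)))) => //.
  by poly_time_access.
Qed.

Lemma poly_time_saturate E {eE : encodable E} (V : E -> seq nat) (S : E -> seq imp) :
  poly_time V -> poly_time S -> poly_time (fun e => saturate (V e) (S e)).
Proof.
move=> VP SP.
have VP1 : forall A (eA : encodable A) (f : A -> E),
    poly_time f -> poly_time (fun a => V (f a)).
  by move=> A eA f; apply: poly_time_comp.
have SP1 : forall A (eA : encodable A) (f : A -> E),
    poly_time f -> poly_time (fun a => S (f a)).
  by move=> A eA f; apply: poly_time_comp.
apply: (poly_time_map (f := fun e i => (reduce_premise (V e) (S e) i.1,
  [seq x <- V e | x \in forward_closure (V e) (S e) i.1]))) => //.
apply: poly_time_pair.
  apply: (poly_time_shrink (P := fun p X x => x \in forward_closure (V p.1) (S p.1) X)).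
    by poly_time_access.
  apply: poly_time_mem; first by poly_time_access.
  by apply: poly_time_forward_closure; [apply: VP1|apply: SP1|]; poly_time_access.
apply: (poly_time_filter (f := fun p x => x \in forward_closure (V p.1) (S p.1) p.2.1)).
  by apply: VP1; poly_time_access.
apply: poly_time_mem; first by poly_time_access.
by apply: poly_time_forward_closure; [apply: VP1|apply: SP1|]; poly_time_access.
Qed.

Lemma poly_time_reduce_conclusion :
  poly_time (fun p : seq nat * seq imp * imp => reduce_conclusion p.1.1 p.1.2 p.2).
Proof.
apply: poly_time_pair; first by poly_time_access.
apply: (poly_time_shrink (P := fun (p : seq nat * seq imp * imp) X x =>
  x \in forward_closure p.1.1 ((p.2.1, X) :: p.1.2) p.2.1)).
  by poly_time_access.
apply: poly_time_mem; first by poly_time_access.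
by apply: poly_time_forward_closure; poly_time_access.
Qed.

Lemma poly_time_optimize :
  poly_time (fun p : seq nat * seq imp => optimize p.1 p.2).
Proof.
apply: (poly_time_filter (f := fun _ i => has predT i.2)); last first.
  apply: (poly_time_has (f := fun _ _ => true)); first by poly_time_access.
  exact: poly_time_const.
apply: poly_time_fst.
apply: (poly_time_comp
  (g := fun p : seq nat * seq imp => foldl (reduce_step p.1) ([::], p.2) p.2)
  (f := fun p => (p.1, saturate p.1 p.2))); last first.
  by poly_time_access; apply: poly_time_saturate; poly_time_access.
(* A step adds to the reduced list one implication no larger than [i] and one cons node, and the
   pending list does not grow. *)
apply: (poly_time_foldl (g := fun p => reduce_step p.1) (h := fun p => code_size p.2 + 1)).
- move=> [U s] [d r] [a b]; rewrite /reduce_step /= !code_size_pair code_size_cons !code_size_pair.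
  have := code_size_shrink (fun X x => x \in forward_closure U ((a, X) :: d ++ behead r) a) b.
  have : code_size (behead r) <= code_size r by exact: code_size_behead.
  by rewrite /reduce_conclusion /=; lia.
- apply: (poly_bounded_snd (h := fun i => code_size i + 1)).
  exact: poly_bounded_add poly_bounded_size (poly_bounded_const _).
- by poly_time_access.
- by poly_time_access; exact: poly_time_const.
- rewrite /reduce_step; poly_time_access.
  apply: (poly_time_comp poly_time_reduce_conclusion
    (f := fun p => (p.1.1, p.2.1.1 ++ behead p.2.1.2, p.2.2))).
  by poly_time_access; apply: poly_time_cat; poly_time_access.
Qed.

(** * Bases of convex geometries *)

Section ConvexGeometry.
Variables (U : finType) (F : {set {set U}}).
Implicit Types (A B C D Q X : {set U}) (Sigma : {set implication U}).
Local Notation phi := (closure_op F).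

Lemma sub_closure A : A \subset phi A.
Proof. by apply/bigcapsP => C /andP[]. Qed.

Lemma closure_min A C : C \in F -> A \subset C -> phi A \subset C.
Proof. by move=> CF AC; apply: bigcap_inf; rewrite CF. Qed.

Lemma closureS A B : A \subset B -> phi A \subset phi B.
Proof.
move=> AB; apply/bigcapsP => C /andP[CF BC].
by apply: closure_min => //; apply: subset_trans BC.
Qed.

Lemma closure_id C : C \in F -> phi C = C.
Proof. by move=> CF; apply/eqP; rewrite eqEsubset sub_closure closure_min. Qed.

Hypothesis csF : closure_system F.

Lemma closure_op_closed A : phi A \in F.
Proof.
case: csF => TF IF; by apply: (big_ind (fun X => X \in F)) => // C /andP[CF _].
Qed.

Lemma closure_idem A : phi (phi A) = phi A.
Proof. exact/closure_id/closure_op_closed. Qed.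

Lemma closed_closure C : (C \in F) = (phi C == C).
Proof. by apply/idP/eqP => [/closure_id//|<-]; apply: closure_op_closed. Qed.

Lemma implicational_baseP Sigma :
  implicational_base F Sigma <->
  forall X, X \in F <-> forall i, i \in Sigma -> i.1 \subset X -> i.2 \subset X.
Proof.
have modelP X : reflect (forall i, i \in Sigma -> i.1 \subset X -> i.2 \subset X)
    [forall i in Sigma, satisfies X i].
  apply: (iffP forall_inP) => H i iS; first exact/implyP/H.
  by apply/implyP/H.
split=> [-> X|FP]; first by rewrite inE; split=> /modelP.
by apply/setP => X; rewrite inE; apply/idP/modelP => /FP.
Qed.

Lemma base_conclusion_sub Sigma i :
  implicational_base F Sigma -> i \in Sigma -> i.2 \subset phi i.1.
Proof.
move=> /implicational_baseP bF iS.
by have /bF := closure_op_closed i.1; apply=> //; apply: sub_closure.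
Qed.

(** [Q] is not closed, hence violates some [i]. If the closure of [i.1] were strictly below that of
    [Q], quasi-closedness would put it, and with it [i.2], inside [Q]. *)
Lemma base_quasi_closed Sigma Q : implicational_base F Sigma -> quasi_closed F Q ->
  exists i, [/\ i \in Sigma, phi i.1 = phi Q, i.1 \subset Q & ~~ (i.2 \subset Q)].
Proof.
move=> bF /andP[QF /forallP qQ].
have /forall_inPn[i iS] : ~~ [forall i in Sigma, satisfies Q i].
  by apply: contra QF => sQ; rewrite bF inE.
rewrite negb_imply => /andP[iQ niQ]; exists i; split=> //.
apply/eqP; rewrite eqEproper closureS //=; apply: contra niQ => lt.
apply: subset_trans (base_conclusion_sub bF iS) _.
by have := qQ i.1; rewrite iQ lt.
Qed.

(** If a model [X] is not closed, take [A] inside [X] whose closure leaves [X] and is smallest. By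
    minimality [X :&: phi A] is quasi-closed, and the implication that it violates is violated by
    [X] too. *)
Lemma quasi_closed_base Sigma :
  (forall i, i \in Sigma -> i.2 \subset phi i.1) ->
  (forall Q, quasi_closed F Q ->
     exists i, [/\ i \in Sigma, i.1 \subset Q & ~~ (i.2 \subset Q)]) ->
  implicational_base F Sigma.
Proof.
move=> valid hit; apply/implicational_baseP => X.
split=> [XF i iS iX|mX].
  by apply: subset_trans (valid i iS) _; apply: closure_min.
apply/negPn/negP => nXF.
have [A /andP[AX nA] Amin] : exists2 A : {set U}, (A \subset X) && ~~ (phi A \subset X) &
    forall B : {set U}, B \subset X -> #|phi B| < #|phi A| -> phi B \subset X.
  have PX : (X \subset X) && ~~ (phi X \subset X).
    rewrite subxx; apply: contra nXF => sX; rewrite closed_closure.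
    by rewrite eqEsubset sX sub_closure.
  case: (arg_minnP (P := fun A : {set U} => (A \subset X) && ~~ (phi A \subset X))
    (fun A => #|phi A|) PX) => A PA Amin; exists A => // B BX ltB.
  by apply/negPn/negP => nB; have := Amin B; rewrite BX nB leqNgt ltB => /(_ isT).
pose Q := X :&: phi A.
have AQ : A \subset Q by rewrite subsetI AX sub_closure.
have phiQ : phi Q = phi A.
  apply/eqP; rewrite eqEsubset [X in _ && X]closureS // andbT.
  by have := closureS (subsetIr X (phi A)); rewrite closure_idem.
have qQ : quasi_closed F Q.
  rewrite /quasi_closed closed_closure phiQ; apply/andP; split.
    by apply: contra nA => /eqP ->; apply: subsetIl.
  apply/forallP => B; apply/implyP => BQ; apply/implyP => ltB.
  rewrite subsetI (proper_sub ltB) andbT.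
  by apply: Amin (proper_card ltB); apply: subset_trans BQ (subsetIl _ _).
have [i [iS iQ /negP[]]] := hit Q qQ.
rewrite subsetI mX //=; last by apply: subset_trans iQ (subsetIl _ _).
by apply: subset_trans (valid i iS) _; rewrite -phiQ; apply: closureS.
Qed.

(* Extending a closed set avoiding [a] to a maximal one [M], the anti-exchange
   axiom forces [a |: M] to be closed. *)
Lemma minimal_generator A D : convex_geometry F ->
  (forall a, a \in A -> a \notin phi (A :\ a)) -> phi D = phi A -> A \subset D.
Proof.
move=> [_ _ ext] Amin eqDA; apply/subsetP => a aA; apply/negPn/negP => aD.
pose P M := [&& M \in F, A :\ a \subset M & a \notin M].
have P0 : P (phi (A :\ a)) by rewrite /P closure_op_closed sub_closure Amin.
have [M /maxsetP[/and3P[MF AM aM] Mmax] _] := maxset_exists P0.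
have MT : M \proper setT by rewrite properT; apply: contra aM => /eqP ->; rewrite inE.
have [x xM xMF] := ext M MF MT.
have xa : x = a.
  apply/eqP/negPn/negP => xa; move/negP: xM; apply.
  rewrite -(Mmax (x |: M)) ?setU11 ?subsetUr // /P xMF /= !inE negb_or eq_sym xa aM.
  by rewrite (subset_trans AM) ?subsetUr.
(* The closed set [a |: M] contains [A], hence [D]. As [D] avoids [a], it lies in [M], so its
   closure misses [a], against [phi D = phi A]. *)
subst x; have DM : phi D \subset M.
  apply: closure_min => //; apply/subsetP => d dD.
  have : d \in a |: M.
    apply/(subsetP (closure_min xMF (A := A) _)); last first.
      by rewrite -eqDA (subsetP (sub_closure D)).
    by rewrite -(setD1K aA) setUS.
  by rewrite !inE => /predU1P[da|//]; rewrite -da dD in aD.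
by move/negP: aM; apply; apply: (subsetP DM); rewrite eqDA (subsetP (sub_closure A)).
Qed.

Definition maximal_quasi_closed C := [set Q | maxset (quasi_closed_of F C) Q].

(** A quasi-closed set of [C] lies in [C], and complementation within [C] is injective on subsets of
    [C]. *)
Lemma card_quasi_closed_edges C :
  #|edges (quasi_closed_hypergraph F C)| = #|maximal_quasi_closed C|.
Proof.
rewrite -(card_in_imset (f := fun Q => C :\: Q) (D := maximal_quasi_closed C)).
  apply: eq_card => E; apply/imsetP/imsetP => -[Q QP ->]; exists Q => //;
  by rewrite !inE in QP *.
move=> Q Q'; rewrite !inE => /maxsetp/andP[_ /eqP CQ] /maxsetp/andP[_ /eqP CQ'] E.
have K R : phi R = C -> C :\: (C :\: R) = R.
  by move=> <-; rewrite setDDr setDv set0U; apply/setIidPr/sub_closure.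
by rewrite -(K Q CQ) -(K Q' CQ') E.
Qed.

(** * Cost that any base must spend on an essential set *)

Section LowerBound.
Variables (Sigma : {set implication U}) (C A : {set U}).
Hypotheses (bF : implicational_base F Sigma) (essC : essential F C).
Hypothesis disj : trivIset (edges (quasi_closed_hypergraph F C)).
Hypothesis minA : forall D, phi D = C -> A \subset D.

(** Some implication has a premise generating [C], and that premise contains [A]. The union [W] of
    the conclusions attached to [C] meets every edge, and disjoint edges need distinct elements of
    [W]. *)
Lemma essential_cost_lower_bound :
  #|A| + #|maximal_quasi_closed C| <=
  \sum_(i in Sigma | phi i.1 == C) (#|i.1| + #|i.2|).
Proof.
have [_ /existsP[Q0 /andP[qQ0 /eqP CQ0]]] := andP essC.
have [i0 [i0S i0C _ _]] := base_quasi_closed bF qQ0; rewrite CQ0 in i0C.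
rewrite big_split leq_add //=.
  rewrite (bigD1 i0) /=; last by rewrite i0S i0C eqxx.
  by apply: leq_trans (leq_addr _ _); apply/subset_leq_card/minA.
pose W := \bigcup_(i in Sigma | phi i.1 == C) i.2.
have WE E : E \in edges (quasi_closed_hypergraph F C) -> 0 < #|E :&: W|.
  case/imsetP => Q; rewrite inE => /maxsetp/andP[qQ /eqP CQ] ->.
  have [i [iS iC iQ /subsetPn[b bi bQ]]] := base_quasi_closed bF qQ.
  rewrite CQ in iC.
  apply/card_gt0P; exists b; rewrite !inE bQ /=; apply/andP; split.
    by rewrite -iC; apply: (subsetP (base_conclusion_sub bF iS)).
  by apply/bigcupP; exists i; rewrite ?iS ?iC ?eqxx.
have card_bigcup : #|W| <= \sum_(i in Sigma | phi i.1 == C) #|i.2|.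
  rewrite /W; elim/big_rec2: _ => [|i n B _ nB]; first by rewrite cards0.
  by rewrite cardsU (leq_trans (leq_subr _ _)) // leq_add2l.
apply: leq_trans card_bigcup; rewrite -card_quasi_closed_edges.
apply: (@leq_trans (\sum_(E in edges (quasi_closed_hypergraph F C)) #|E :&: W|)).
  by rewrite -sum1_card; apply: leq_sum => E /WE.
(* Double counting of incidences: by disjointness each element of [W] lies in at most one edge. *)
rewrite -sum1_card; under eq_bigr => E _ do rewrite -sum1_card.
rewrite (exchange_big_dep (mem W)) /=; last by move=> E x _; rewrite inE => /andP[].
apply: leq_sum => x xW; rewrite sum1dep_card.
apply/card_le1_eqP => E E'; rewrite !inE xW !andbT => /andP[EP xE] /andP[E'P xE'].
apply/esym/eqP/negPn/negP => EE'; have /trivIsetP/(_ E E' EP E'P EE') := disj.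
by rewrite disjoint_subset => /subsetP/(_ x xE); rewrite !inE xE'.
Qed.
End LowerBound.

(** * Size of the conclusions in an irredundant base *)

Section UpperBound.
Variable Sigma : {set implication U}.
Hypothesis bF : implicational_base F Sigma.
Hypothesis inj : {in Sigma &, forall i j, phi i.1 = phi j.1 -> i = j}.
Hypothesis irr : forall i b, i \in Sigma -> b \in i.2 ->
  ~ implicational_base F ((i.1, i.2 :\ b) |: (Sigma :\ i)).

(** After the removal of [b], some quasi-closed [Q] violates nothing, so [i] was the only
    implication violated there: [Q] contains the rest of [i.2] and has the closure of [i.1]. In a
    maximal [Q'] above [Q] an implication with this closure still fails; by [inj] it is [i], so [b]
    stays outside. *)
Lemma irredundant_witness i b : i \in Sigma -> b \in i.2 ->
  exists2 Q, Q \in maximal_quasi_closed (phi i.1) & i.2 :\: Q = [set b].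
Proof.
move=> iS bi.
have [Q [qQ CQ ib]] : exists Q,
    [/\ quasi_closed F Q, phi Q = phi i.1 & i.2 :\ b \subset Q].
  pose Sigma' := (i.1, i.2 :\ b) |: (Sigma :\ i).
  pose hit Q := [exists j in Sigma', (j.1 \subset Q) && ~~ (j.2 \subset Q)].
  case: (boolP [forall Q, quasi_closed F Q ==> hit Q]) => [/forallP hitP|].
    case: (irr iS bi); apply: quasi_closed_base => [j|Q qQ].
      rewrite !inE => /predU1P[->|/andP[_ jS]]; last exact: base_conclusion_sub bF jS.
      by apply: subset_trans (subsetDl _ _) _; apply: base_conclusion_sub bF iS.
    have /implyP/(_ qQ)/existsP[j /and3P[jS jQ njQ]] := hitP Q.
    by exists j.
  rewrite negb_forall => /existsP[Q]; rewrite negb_imply => /andP[qQ].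
  move/existsPn => nohit; exists Q.
  have [j [jS jC jQ njQ]] := base_quasi_closed bF qQ.
  have ji : j = i.
    apply/eqP/negPn/negP => ji; have := nohit j.
    by rewrite !inE ji jS jQ njQ orbT.
  subst j; split=> //; have := nohit (i.1, i.2 :\ b).
  by rewrite !inE eqxx jQ /= negbK.
have qQC : quasi_closed_of F (phi i.1) Q by rewrite /quasi_closed_of qQ CQ eqxx.
have [Q' maxQ' QQ'] := maxset_exists qQC.
exists Q'; first by rewrite inE.
have /andP[qQ' /eqP CQ'] := maxsetp maxQ'.
have [j [jS jC jQ' njQ']] := base_quasi_closed bF qQ'.
have ji : j = i by apply: inj => //; rewrite jC.
subst j; apply/eqP; rewrite eqEsubset sub1set !inE bi andbT; apply/andP; split.
  apply/subsetP => x; rewrite !inE => /andP[xQ' xi]; apply/negPn/negP => xb.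
  move/negP: xQ'; apply; apply: (subsetP QQ'); apply: (subsetP ib).
  by rewrite !inE xb.
apply: contra njQ' => bQ'; rewrite -(setD1K bi) subUset sub1set bQ' /=.
exact: subset_trans ib QQ'.
Qed.

Lemma irredundant_conclusion i : i \in Sigma ->
  #|i.2| <= #|maximal_quasi_closed (phi i.1)|.
Proof.
move=> iS.
(* The set chosen for [b] determines [b], so the choice is injective on [i.2], where the default
   [set0] is never reached. *)
pose w b := odflt set0 [pick Q in maximal_quasi_closed (phi i.1) | i.2 :\: Q == [set b]].
have wP b : b \in i.2 -> w b \in maximal_quasi_closed (phi i.1) /\ i.2 :\: w b = [set b].
  move=> bi; rewrite /w; case: pickP => [Q /andP[? /eqP]//|no].
  by have [Q Qmax Qb] := irredundant_witness iS bi; have := no Q; rewrite Qmax Qb eqxx.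
rewrite -(card_in_imset (f := w) (D := i.2)).
  by apply/subset_leq_card/subsetP => _ /imsetP[b /wP[? _] ->].
move=> b c /wP[_ wb] /wP[_ wc] bc; apply/set1P.
by rewrite -wc -bc wb set11.
Qed.
End UpperBound.

(** Each implication of [Sigma] costs at most what [Sigma'] spends on the same closure. Closures of
    distinct implications of [Sigma] differ, so each implication of [Sigma'] is charged at most
    once. *)
Lemma irredundant_base_optimum Sigma : convex_geometry F ->
  (forall C, essential F C -> trivIset (edges (quasi_closed_hypergraph F C))) ->
  implicational_base F Sigma ->
  (forall i a, i \in Sigma -> a \in i.1 -> a \notin phi (i.1 :\ a)) ->
  (forall i, i \in Sigma -> i.2 != set0) ->
  {in Sigma &, forall i j, phi i.1 = phi j.1 -> i = j} ->
  (forall i b, i \in Sigma -> b \in i.2 ->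
    ~ implicational_base F ((i.1, i.2 :\ b) |: (Sigma :\ i))) ->
  optimum_base F Sigma.
Proof.
move=> cgF disj bF minS nz inj irr; split=> // Sigma' bF'.
have ess i : i \in Sigma -> essential F (phi i.1).
  move=> iS; rewrite /essential closure_op_closed; apply/existsP.
  have /set0Pn[b bi] := nz i iS.
  have [Q] := irredundant_witness bF inj irr iS bi; rewrite inE => /maxsetp qQ _.
  by exists Q.
apply: (@leq_trans (\sum_(i in Sigma)
  \sum_(j in Sigma' | phi j.1 == phi i.1) (#|j.1| + #|j.2|))).
  apply: leq_sum => i iS.
  apply: leq_trans
    (essential_cost_lower_bound bF' (ess i iS) (disj _ (ess i iS)) (A := i.1) _).
    by rewrite leq_add2l; apply: irredundant_conclusion bF inj irr _ iS.
  by move=> D Di; apply: minimal_generator => // a; apply: minS.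
rewrite (exchange_big_dep (mem Sigma')) /=; last by move=> i j _ /andP[].
apply: leq_sum => j jS; rewrite sum_nat_cond_const -[leqRHS]mul1n leq_mul2r.
apply/orP; right; apply/card_le1_eqP => i i'.
rewrite !inE => /and3P[iS _ /eqP ij] /and3P[i'S _ /eqP i'j].
by apply: inj => //; rewrite -ij -i'j.
Qed.
End ConvexGeometry.

(** * Correctness of the algorithm *)

Lemma uniq_map_inj_in (T T' : eqType) (f : T -> T') s :
  uniq (map f s) -> {in s &, injective f}.
Proof.
elim: s => //= x s IH /andP[fx us] y z; rewrite !inE.
case/predU1P=> [->|ys] /predU1P[->|zs] // fyz; last exact: IH.
- by case/negP: fx; rewrite fyz map_f.
- by case/negP: fx; rewrite -fyz map_f.
Qed.

Section ListLemmas.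
Variable T : eqType.
Implicit Types (X Y : seq T) (P : seq T -> T -> bool).

Lemma mem_chain (S : seq (seq T * seq T)) X Y (x : T) :
  reflect (x \in X \/ exists i, [/\ i \in S, {subset i.1 <= Y} & x \in i.2])
          (x \in chain S X Y).
Proof.
rewrite mem_cat; apply: (iffP orP) => -[xX|].
- by left.
- case/flattenP => _ /mapP[i] /[!mem_filter] /andP[/allP iY iS] -> xi.
  by right; exists i.
- by left.
- case=> i [iS iY xi]; right; apply/flattenP; exists i.2 => //.
  by apply/mapP; exists i => //; rewrite mem_filter iS andbT; apply/allP.
Qed.

Lemma shrink_ind P (Q : seq T -> Prop) X :
  Q X -> (forall Y x, Q Y -> P (delete x Y) x -> Q (delete x Y)) -> Q (shrink P X).
Proof.
move=> QX QP; rewrite /shrink; elim: X {1 2}X QX => //= x s IH Y QY.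
by apply: IH; case: ifP => // xP; apply: QP.
Qed.

Lemma mem_delete x y X : (y \in delete x X) = (y != x) && (y \in X).
Proof. exact: mem_filter. Qed.

Lemma shrink_sub P X : {subset shrink P X <= X}.
Proof.
apply: (@shrink_ind P (fun Y => {subset Y <= X})) => // Y x YX _ y.
by rewrite mem_delete => /andP[_ /YX].
Qed.

Lemma shrink_uniq P X : uniq X -> uniq (shrink P X).
Proof.
move=> uX; apply: (shrink_ind (Q := fun Y => uniq Y)) => // Y x uY _.
exact: filter_uniq.
Qed.

(** An element survives its visit because [P] fails at that moment; later deletions only shrink the
    list, and by monotonicity [P] still fails at the end. *)
Lemma shrink_minimal P X x :
  (forall Y Y' y, {subset Y' <= Y} -> P Y' y -> P Y y) ->
  x \in shrink P X -> ~~ P (delete x (shrink P X)) x.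
Proof.
move=> Pmono; suff H s Y :
    let R := foldl (fun Y x => if P (delete x Y) x then delete x Y else Y) Y s in
    {subset R <= Y} /\ forall x, x \in s -> x \in R -> ~~ P (delete x R) x.
  by move=> xR; apply: (H X X).2 => //; apply: shrink_sub xR.
elim: s Y => [|y s IH] Y /=; first by split.
set Y' := if _ then _ else _.
have [RY' Rmin] := IH Y'.
have Y'Y : {subset Y' <= Y}.
  by rewrite /Y'; case: ifP => _ z //; rewrite mem_delete => /andP[].
split=> [z /RY' /Y'Y //|z /predU1P[->{z} yR|]]; last exact: Rmin.
case: (boolP (P (delete y Y) y)) => [Py|nP].
  have := RY' _ yR; have -> : Y' = delete y Y by rewrite /Y' Py.
  by rewrite mem_delete eqxx.
apply: contra nP; apply: Pmono => z; rewrite !mem_delete => /andP[-> /RY' /Y'Y //].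
Qed.
End ListLemmas.

(** * Forward chaining as a least model *)

Section ForwardClosure.
Variable U : finType.
Implicit Types (X Y : seq U) (Z : {set U}) (i j : seq U * seq U).
Implicit Types S R : seq (seq U * seq U).

Definition respects Z i := {subset i.1 <= Z} -> {subset i.2 <= Z}.
Definition model S Z := {in S, forall i, respects Z i}.

Lemma forward_closure_model S X : model S [set x in forward_closure (enum U) S X].
Proof.
(* On sets a round is the monotone operator [G], whose least fixed point [fixset G] is its iterate
   of order [#|U|] from the empty set. *)
pose G Z := [set x in chain S X (enum Z)].
have Gmono : {homo G : Z Z' / Z \subset Z'}.
  move=> Z Z' /subsetP ZZ'; apply/subsetP => x; rewrite !inE => /mem_chain xP; apply/mem_chain.
  case: xP => [xX|[i [iS iZ xi]]]; [by left|right; exists i; split=> //].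
  by move=> y /iZ; rewrite !mem_enum => /ZZ'.
have GE n : [set x in iter n (chain S X) [::]] = iter n G set0.
  elim: n => [|n IH /=]; first by apply/setP => x; rewrite !inE.
  rewrite -IH; apply/setP => x; rewrite !inE; apply/mem_chain/mem_chain;
    (case=> [xX|[i [iS iZ xi]]]; [by left|right; exists i; split=> // y /iZ]);
    by rewrite mem_enum inE.
have fcE : [set x in forward_closure (enum U) S X] = fixset G.
  by rewrite /forward_closure -cardE GE.
move=> i iS iZ x xi; rewrite fcE -(fixsetK Gmono) inE; apply/mem_chain; right.
by exists i; split=> // y /iZ; rewrite fcE mem_enum.
Qed.

Lemma sub_forward_closure S X : {subset X <= forward_closure (enum U) S X}.
Proof.
move=> x xX; rewrite /forward_closure.
have : x \in enum U by rewrite mem_enum.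
(* The vertex [x] makes [enum U] nonempty, so at least one round takes place. *)
case: (enum U) => //= y s _; apply/mem_chain; by left.
Qed.

Lemma forward_closure_min S X Z :
  model S Z -> {subset X <= Z} -> {subset forward_closure (enum U) S X <= Z}.
Proof.
move=> mZ XZ; rewrite /forward_closure; elim: (size _) => //= n IH x /mem_chain[/XZ //|].
by case=> i [iS iX]; apply: (mZ i iS) => y /iX /IH.
Qed.

Lemma forward_closureP S X x :
  reflect (forall Z, model S Z -> {subset X <= Z} -> x \in Z)
          (x \in forward_closure (enum U) S X).
Proof.
apply: (iffP idP) => [xX Z mZ XZ|]; first exact: forward_closure_min mZ XZ _ xX.
move=> /(_ [set y in forward_closure (enum U) S X]); rewrite inE; apply.
  exact: forward_closure_model.
by move=> y yX; rewrite inE; apply: sub_forward_closure.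
Qed.

Lemma forward_closure_mono S X Y :
  {subset X <= Y} ->
  {subset forward_closure (enum U) S X <= forward_closure (enum U) S Y}.
Proof.
move=> XY x /forward_closureP xX; apply/forward_closureP => Z mZ YZ; apply: xX => //.
by move=> y /XY /YZ.
Qed.
End ForwardClosure.

(** * Saturation, reduction of conclusions and their invariant *)

Section Correctness.
Variables (U : finType) (F : {set {set U}}).
Hypothesis cgF : convex_geometry F.
Implicit Types (X Y A : seq U) (Z : {set U}) (i j : seq U * seq U).
Implicit Types S R D : seq (seq U * seq U).
Local Notation phi := (closure_op F).
Local Notation premise i := [set x in (i : seq U * seq U).1].

Let csF : closure_system F. Proof. by case: cgF. Qed.

(** Counterpart of [implicational_base] on lists, insensitive to order and to repetitions. *)
Definition list_base S := forall Z, Z \in F <-> model S Z.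

Lemma listed_base S :
  list_base S <-> implicational_base F [set i in listed_implications S].
Proof.
have subE X Z : [set x in X] \subset Z <-> {subset X <= Z}.
  split=> [/subsetP XZ x xX|XZ]; first by apply: XZ; rewrite inE.
  by apply/subsetP => x; rewrite inE => /XZ.
have mE S' Z : model S' Z <-> forall i : implication U,
    i \in [set i in listed_implications S'] -> i.1 \subset Z -> i.2 \subset Z.
  split=> [mZ _ /[!inE] /mapP[i iS ->] /= /subE iZ|mZ i iS /subE iZ].
    exact/subE/(mZ i).
  by apply/subE/(mZ ([set x in i.1], [set x in i.2])) => //; rewrite inE map_f.
split=> [bS|/(implicational_baseP F _) bS Z].
  by apply/(implicational_baseP F _) => Z; split=> [/bS/mE|/mE/bS].
by split=> [/bS/mE|/mE/bS].
Qed.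

Lemma forward_closureE S A : list_base S ->
  forward_closure (enum U) S A =i phi [set x in A].
Proof.
move=> bS x; apply/idP/idP.
  move=> /forward_closureP; apply; first by apply/bS; apply: closure_op_closed.
  by move=> y yA; apply: (subsetP (sub_closure _ _)); rewrite inE.
move=> xA; rewrite -[_ \in _]in_set; apply: (subsetP _ x xA); apply: closure_min.
  exact/bS/forward_closure_model.
by apply/subsetP => y; rewrite !inE; apply: sub_forward_closure.
Qed.

Definition minimal_premise A := forall a, a \in A -> a \notin phi ([set x in A] :\ a).

Lemma set_delete a A : [set x in delete a A] = [set x in A] :\ a.
Proof. by apply/setP => x; rewrite !inE mem_delete. Qed.

Lemma reduce_premise_sub S A : {subset reduce_premise (enum U) S A <= A}.
Proof. exact: shrink_sub. Qed.

Lemma reduce_premise_minimal S A : list_base S ->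
  minimal_premise (reduce_premise (enum U) S A).
Proof.
move=> bS a aA; rewrite -set_delete -(forward_closureE _ bS).
apply: (shrink_minimal (P := fun X x => x \in forward_closure (enum U) S X)) aA => Y Y' y.
by move=> /forward_closure_mono; apply.
Qed.

Lemma closure_reduce_premise S A : list_base S ->
  phi [set x in reduce_premise (enum U) S A] = phi [set x in A].
Proof.
move=> bS; rewrite /reduce_premise.
apply: (shrink_ind (Q := fun Y => phi [set x in Y] = phi [set x in A])) => // Y a <-.
rewrite (forward_closureE _ bS) set_delete => aY.
apply/eqP; rewrite eqEsubset closureS ?subsetDl //=.
apply: closure_min; first exact: closure_op_closed.
apply/subsetP => y yY; have [-> //|ya] := eqVneq y a.
by apply: (subsetP (sub_closure _ _)); rewrite in_setD1 ya.
Qed.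

Definition saturated i := [/\ uniq i.1, uniq i.2, minimal_premise i.1 & i.2 =i phi (premise i)].

Lemma saturateP S : all (fun i => uniq i.1) S -> list_base S ->
  {in saturate (enum U) S, forall i, saturated i}.
Proof.
move=> /allP uS bS _ /mapP[i iS ->]; split=> /=.
- by apply: shrink_uniq; apply: uS.
- by apply: filter_uniq; apply: enum_uniq.
- exact: reduce_premise_minimal.
- move=> x; rewrite mem_filter mem_enum andbT (forward_closureE _ bS).
  by rewrite closure_reduce_premise.
Qed.

(** The new conclusions are closures of the new premises, so closed sets are models. Conversely each
    old implication follows from its saturated form, whose premise is smaller and whose conclusion
    is larger. *)
Lemma saturate_base S :
  all (fun i => uniq i.1) S -> list_base S -> list_base (saturate (enum U) S).
Proof.
move=> uS bS Z; split=> [ZF i iS iZ x|mZ].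
  have [_ _ _ ->] := saturateP uS bS iS; apply/subsetP; apply: closure_min => //.
  by apply/subsetP => y; rewrite inE => /iZ.
apply/bS => i iS iZ x xi.
apply: (mZ _ (map_f _ iS)) => /= [y /reduce_premise_sub /iZ //|].
rewrite mem_filter mem_enum andbT; apply/forward_closureP => Z' mZ' iZ'; exact: (mZ' i).
Qed.

Lemma reduce_conclusion_sub R i : {subset (reduce_conclusion (enum U) R i).2 <= i.2}.
Proof. exact: shrink_sub. Qed.

(** An element is dropped only if forward chaining from [i.1] recovers it, so every model of the
    shorter list that contains [i.1] still contains it. *)
Lemma reduce_conclusion_base R i :
  list_base (i :: R) -> list_base (reduce_conclusion (enum U) R i :: R).
Proof.
move=> bR; rewrite /reduce_conclusion.
apply: (shrink_ind (Q := fun Y => list_base ((i.1, Y) :: R))) => [|Y b bY /forward_closureP bP Z].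
  by case: (i) bR.
split=> [/bY mZ j|mZ].
  rewrite inE => /predU1P[->|jR]; last by apply: mZ; rewrite inE jR orbT.
  by move=> /= iZ x; rewrite mem_delete => /andP[_]; apply: (mZ (i.1, Y)) => //; apply: mem_head.
apply/bY => j; rewrite inE => /predU1P[->|jR]; last by apply: mZ; rewrite inE jR orbT.
move=> /= iZ x xY; have [->|xb] := eqVneq x b; first exact: bP.
by apply: (mZ (i.1, delete b Y)) => //=; rewrite ?mem_head // mem_delete xb.
Qed.

Lemma reduce_conclusion_irredundant R i b :
  b \in (reduce_conclusion (enum U) R i).2 ->
  exists Z, [/\ model R Z, {subset i.1 <= Z},
    {subset delete b (reduce_conclusion (enum U) R i).2 <= Z} & b \notin Z].
Proof.
move=> bR.
pose Y := delete b (reduce_conclusion (enum U) R i).2.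
have nb : b \notin forward_closure (enum U) ((i.1, Y) :: R) i.1.
  apply: (shrink_minimal
    (P := fun X x => x \in forward_closure (enum U) ((i.1, X) :: R) i.1)) bR.
  move=> Y1 Y2 y Y21 /forward_closureP yP.
  apply/forward_closureP => Z mZ iZ; apply: yP => // j.
  rewrite inE => /predU1P[->|jR]; last by apply: mZ; rewrite inE jR orbT.
  by move=> /= _ x /Y21; apply: (mZ (i.1, Y1)); rewrite ?mem_head.
(* The least model above [i.1] once [b] is dropped; it misses [b], for otherwise [shrink] would have
   deleted [b]. *)
exists [set x in forward_closure (enum U) ((i.1, Y) :: R) i.1].
have m := @forward_closure_model _ ((i.1, Y) :: R) i.1.
have s : {subset i.1 <= [set x in forward_closure (enum U) ((i.1, Y) :: R) i.1]}.
  by move=> x xi; rewrite inE; apply: sub_forward_closure.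
split=> //.
- by move=> j jR; apply: m; rewrite inE jR orbT.
- by apply: (m (i.1, Y)); rewrite ?mem_head.
- by rewrite inE.
Qed.

(* [D] holds the implications already reduced, [S] those still saturated. *)
Record reduction_invariant D S : Prop := {
  inv_base : list_base (D ++ S);
  inv_irredundant : forall i b, i \in D -> b \in i.2 ->
    exists Z, [/\ {in D ++ S, forall j, j != i -> respects Z j},
      {subset i.1 <= Z}, {subset delete b i.2 <= Z} & b \notin Z];
  inv_fresh : forall i j, i \in D -> j \in S -> has predT i.2 -> premise i <> premise j;
  inv_uniq : uniq [seq premise i | i <- D & has predT i.2];
  inv_reduced : {in D, forall i, [/\ uniq i.1, uniq i.2 & minimal_premise i.1]};
  inv_saturated : {in S, forall i, saturated i} }.

(** Earlier witnesses survive because reducing [i] only weakens it, and premises stay distinct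
    because a later implication with the premise of [i] makes the whole conclusion of [i]
    redundant. *)
Lemma reduction_invariant_step D S i : reduction_invariant D (i :: S) ->
  reduction_invariant (reduce_conclusion (enum U) (D ++ S) i :: D) S.
Proof.
case=> base irr fresh un red sat; set i' := reduce_conclusion _ _ _.
have i'1 : i'.1 = i.1 by [].
have [ui1 ui2 mi si] := sat i (mem_head _ _).
split.
- apply: reduce_conclusion_base => Z; apply: iff_trans (base Z) _.
  by split=> mZ j jS; apply: mZ; move: jS; rewrite !(mem_cat, inE) orbCA.
- move=> k b; rewrite inE => /predU1P[-> bi'|kD bk].
    have [Z [mZ iZ bZ nb]] := reduce_conclusion_irredundant bi'.
    by exists Z; split=> // j; rewrite inE => /predU1P[->|/mZ//]; rewrite eqxx.
  have [Z [mZ kZ bZ nb]] := irr k b kD bk; exists Z; split=> // j.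
  have DSi : {subset D ++ S <= D ++ i :: S}.
    by move=> l; rewrite !mem_cat inE => /orP[->//|->]; rewrite !orbT.
  rewrite inE => /predU1P[-> _|/DSi jDS]; last exact: mZ.
  (* The witness of [k] respects every implication but [k]; it respects [i] since freshness
     separates their premises, the conclusion of [k] containing [b]. *)
  have ik : i != k.
    apply/eqP => ik; apply: (fresh k i kD (mem_head _ _)); last by rewrite ik.
    by apply/hasP; exists b.
  rewrite /respects i'1 => iZ x /reduce_conclusion_sub.
  by apply: (mZ i) => //; rewrite mem_cat mem_head orbT.
- move=> k j; rewrite inE => /predU1P[-> jS /hasP[b bi' _] ij|kD jS].
    (* With equal premises, the witness would respect the saturated [j] and so contain the closure
       of [i.1], including [b]. *)
    have [Z [mZ iZ _ /negP[]]] := reduce_conclusion_irredundant bi'.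
    have jiS : j \in i :: S by rewrite inE jS orbT.
    have [_ _ _ sj] := sat j jiS.
    apply: (mZ j); first by rewrite mem_cat jS orbT.
      by move=> x xj; apply: iZ; move/setP/(_ x): ij; rewrite !inE i'1 xj.
    by rewrite sj -ij -/(premise i) -si; apply: reduce_conclusion_sub bi'.
  by apply: fresh => //; rewrite inE jS orbT.
- rewrite /=; case: ifP => //= hi'; rewrite un andbT.
  apply/negP => /mapP[j]; rewrite mem_filter => /andP[hj jD] ij.
  by apply: (fresh j i jD (mem_head _ _) hj); rewrite -ij.
- move=> j; rewrite inE => /predU1P[->|/red//]; split=> //.
  exact: shrink_uniq.
- by move=> j jS; apply: sat; rewrite inE jS orbT.
Qed.

Lemma reduction_invariant_foldl D S : reduction_invariant D S ->
  reduction_invariant (foldl (reduce_step (enum U)) (D, S) S).1 [::].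
Proof.
by elim: S D => //= i S IH D /reduction_invariant_step; apply: IH.
Qed.

Lemma optimize_invariant S : all (fun i => uniq i.1) S -> list_base S ->
  reduction_invariant (reduce_conclusions (enum U) (saturate (enum U) S)) [::].
Proof.
move=> uS bS; apply: reduction_invariant_foldl; split=> //.
  exact: saturate_base.
exact: saturateP.
Qed.

Lemma optimize_optimum S :
  (forall C, essential F C -> trivIset (edges (quasi_closed_hypergraph F C))) ->
  all (fun i => uniq i.1) S -> list_base S ->
  let L := optimize (enum U) S in
  lists L [set i in listed_implications L] /\
  optimum_base F [set i in listed_implications L].
Proof.
move=> disj uS bS L; have := optimize_invariant uS bS.
set D := reduce_conclusions _ _ => -[]; rewrite cats0 => base irr _ un red _.
have LD : {subset L <= D} by move=> i; rewrite mem_filter => /andP[].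
have bL : list_base L.
  move=> Z; apply: iff_trans (base Z) _; split=> [mZ i /LD /mZ //|mZ i iD].
  case: (boolP (has predT i.2)) => [hi|]; first by apply: mZ; rewrite mem_filter hi.
  by rewrite has_predT -leqNgt leqn0 size_eq0 /respects => /eqP -> _ x.
split.
  rewrite /lists eqxx andbT; apply/andP; split.
    by apply/allP => i /LD /red[-> ->].
  by apply: (@map_uniq _ _ fst); rewrite -map_comp.
have bSigma := (listed_base L).1 bL.
apply: irredundant_base_optimum => //.
- move=> _ a /[!inE] /mapP[i /LD /red[_ _ mi] ->]; rewrite inE; exact: mi.
- move=> _ /[!inE] /mapP[i /[!mem_filter] /andP[/hasP[b bi _] _] ->].
  by apply/set0Pn; exists b; rewrite inE.
(* Minimal premises with the same closure contain each other by [minimal_generator], and the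
   premises kept are pairwise distinct. *)
- move=> _ _ /[!inE] /mapP[i iL ->] /mapP[j jL ->] /= ij.
  have mg k l : k \in L -> phi (premise l) = phi (premise k) -> premise k \subset premise l.
    move=> /LD /red[_ _ mk]; apply: minimal_generator => // a; rewrite inE; exact: mk.
  have pij : premise i = premise j by apply/eqP; rewrite eqEsubset !mg.
  by rewrite (uniq_map_inj_in un iL jL pij).
(* If [b] could be dropped, the witness [Z] would be closed, hence respect [i] and contain [b]. *)
- move=> _ b /[!inE] /mapP[i iL ->] /=; rewrite inE => bi bF.
  have [Z [mZ iZ bZ /negP[]]] := irr i b (LD _ iL) bi.
  suff ZF : Z \in F by apply: (iffLR (base Z) ZF i (LD _ iL)).
  apply/((implicational_baseP F _).1 bF) => k.
  rewrite !inE => /predU1P[-> _|/andP[ki /mapP[k' k'L kE]]].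
    by apply/subsetP => x; rewrite !inE => /andP[xb xi]; apply: bZ; rewrite mem_delete xb.
  have k'i : k' != i by apply: contra ki => /eqP <-; rewrite kE.
  rewrite kE => /subsetP k'Z; apply/subsetP => x; rewrite inE.
  by apply: (mZ k' (LD _ k'L) k'i) => y yk; apply: k'Z; rewrite inE.
Qed.
End Correctness.

(** * Size of the encoded input *)

Section InputSize.
Variable U : finType.
Implicit Types (s : seq U) (l : seq (seq U * seq U)).

Definition rank (x : U) : nat := enum_rank x.

Lemma rank_inj : injective rank.
Proof. by move=> x y /ord_inj /enum_rank_inj. Qed.

Lemma encode_ranks s : encode (map rank s) = code_vertices s.
Proof. by rewrite /encode /encodable_seq -map_comp. Qed.

Lemma encode_implications l : encode (map (map_implication rank) l) = code_implications l.
Proof.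
rewrite /encode /encodable_seq -map_comp; congr tree_of_list.
by apply: eq_map => i /=; rewrite -!encode_ranks.
Qed.

Lemma encode_input l :
  encode (map rank (enum U), map (map_implication rank) l) = code_input l.
Proof. by rewrite /code_input -encode_ranks -encode_implications. Qed.

Lemma size_tree_of_nat n : tree_size (tree_of_nat n) = n.*2.+1.
Proof. by elim: n => //= n ->; lia. Qed.

Lemma size_code_vertices s :
  tree_size (code_vertices s) <= (size s * (2 * #|U| + 2)).+1.
Proof.
elim: s => // x s IH.
rewrite -[code_vertices _]/(node (tree_of_nat (rank x)) (code_vertices s)) /=.
have: rank x < #|U| by apply: ltn_ord.
by move: #|U| IH => n; rewrite size_tree_of_nat mulSn; lia.
Qed.

Lemma size_code_implications l :
  tree_size (code_implications l) <=
  (4 * size l + (\sum_(i <- l) (size i.1 + size i.2)) * (2 * #|U| + 2)).+1.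
Proof.
elim: l => [|i l IH]; first by rewrite big_nil.
rewrite -[code_implications _]/(node (node (code_vertices i.1) (code_vertices i.2))
  (code_implications l)).
move: IH (size_code_vertices i.1) (size_code_vertices i.2); rewrite big_cons /=.
by move: (2 * #|U| + 2) => M; rewrite !mulnDl; lia.
Qed.

Lemma lists_size l Sigma : lists l Sigma ->
  \sum_(i <- l) (size i.1 + size i.2) = total_size Sigma.
Proof.
case/and3P => /allP ul ull /eqP <-; rewrite /total_size.
under [RHS]eq_bigl => i do rewrite inE.
rewrite -big_uniq // big_map !big_seq; apply: eq_bigr => i /ul/andP[u1 u2] /=.
by rewrite !cardsE (card_uniqP u1) (card_uniqP u2).
Qed.

(* The implication between empty sets is the only one of size [0]. *)
Lemma card_total_size (Sigma : {set implication U}) : #|Sigma| <= (total_size Sigma).+1.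
Proof.
rewrite (cardsD1 (set0, set0)) -add1n leq_add ?leq_b1 //.
rewrite -sum1_card big_mkcond /total_size [leqRHS]big_mkcond; apply: leq_sum => -[A B] _.
rewrite !inE /=; case: (_ \in Sigma); rewrite ?andbF // andbT.
by case: ifP => // AB; rewrite lt0n addn_eq0 !cards_eq0 -xpair_eqE.
Qed.

Lemma lists_length l Sigma : lists l Sigma -> size l <= (total_size Sigma).+1.
Proof.
case/and3P => _ ull /eqP E; apply: leq_trans (card_total_size _).
by rewrite -E cardsE (card_uniqP ull) size_map.
Qed.

(** Each of the [#|U| + total_size Sigma] occurrences of vertices costs a unary rank, linear in
    [#|U|]; this makes the code at most quadratic. *)
Lemma size_code_input l Sigma : lists l Sigma ->
  tree_size (code_input l) + 2 <= 9 * (#|U| + total_size Sigma).+1 ^ 2.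
Proof.
move=> lS; have := size_code_vertices (enum U); have := size_code_implications l.
have := lists_length lS; rewrite (lists_size lS) -cardE /=.
move: (total_size _) (tree_size (code_vertices _)) (tree_size _) (size l) #|U|; nia.
Qed.
End InputSize.

(** For positive [n], [n.+1 <= 2 * n] turns 9 into 36; the added constant covers [n = 0]. *)
Lemma polynomial_envelope n k : (9 * n.+1 ^ 2) ^ k <= 36 ^ k * n ^ (2 * k) + 36 ^ k.
Proof.
case: k => [|k]; first by rewrite !expn0.
case: n => [|n]; first by apply: leq_trans (leq_addl _ _); rewrite leq_exp2r.
apply: leq_trans (leq_addr _ _); rewrite expnM -expnMn leq_exp2r //; nia.
Qed.

Theorem theorem2 :
  exists (c : cmd) (a k : nat),
  forall (U : finType) (F : {set {set U}}) (Sigma : {set implication U})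
         (l : seq (seq U * seq U)),
    convex_geometry F ->
    implicational_base F Sigma ->
    (forall C : {set U}, essential F C ->
       trivIset (edges (quasi_closed_hypergraph F C))) ->
    lists l Sigma ->
    exists (s : store) (t : nat)
           (Sigma' : {set implication U}) (l' : seq (seq U * seq U)),
      [/\ exec c (init_store (code_input l)) t s,
          t <= a * (#|U| + total_size Sigma) ^ k + a,
          output s = code_implications l',
          lists l' Sigma' &
          optimum_base F Sigma'].
Proof.
have [_ [c [m [T [[k Tk] _ cT]]]]] := poly_time_optimize.
exists c, (36 ^ k), (2 * k) => U F Sigma l cgF bF disj lS.
have [t [s [ex tT [out _]]]] := cT
  (map (@rank U) (enum U), map (map_implication (@rank U)) l)
  (init_store (code_input l)) (esym (encode_input l)).
have [ul _ /eqP lSigma] := and3P lS.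
have bl : list_base F l by apply/listed_base; rewrite lSigma.
have ul1 : all (fun i => uniq i.1) l by apply: sub_all ul => i /andP[].
have [lL optL] := optimize_optimum cgF disj ul1 bl.
exists s, t; do 2 eexists; split; [exact: ex| | |exact: lL|exact: optL].
  apply: leq_trans (polynomial_envelope _ _); apply: leq_trans tT (leq_trans (Tk _) _).
  rewrite /code_size encode_input; case: (k) => // n; rewrite leq_exp2r //.
  exact: size_code_input.
(* The output on ranks is the renaming of the list that [optimize] yields on vertices. *)
by rewrite /output out /= (map_optimize (@rank_inj U)) encode_implications.
Qed.
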